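(* Let $d \ge 0$ be an integer and set $D = \frac{d(d+1)}{2}$. Let $q$ be a prime, let $\chi$ be a non-principal multiplicative (Dirichlet) character modulo $q$, and let $f$ be a real-valued polynomial of degree $d$. Then for every integer $r \ge 1$ and every real $H$ with $H < q^{\frac{1}{2} + \frac{1}{4r}}$ we have \[ \sum_{N<n \le N+H} e(f(n))\chi(n) \ll_{r,d} H^{1-\frac{1}{r}} q^{\frac{r+1+D}{4r^2}} (\log q)^2, \] uniformly in $N$; here the implied constant depends only on $r$ and $d$ (and not on $N$, $H$, $f$, $\chi$ or $q$).
   Context: $e(t) = e^{2\pi i t}$. The sum runs over integers $n$ in the interval $(N, N+H]$, where $N$ is real.
   Formalization: The formal theorem assumes H ≥ 1; the bound as stated fails for 0 < H < 1 and r ≥ 2, since the sum can be a single term of modulus 1 while H^{1-1/r} tends to 0 as H → 0. *)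

(* Defs.v *)
From HB Require Import structures.
From mathcomp Require Import all_boot all_order all_algebra.
From mathcomp Require Import complex.
From mathcomp Require Import all_classical all_reals all_analysis.

Set Implicit Arguments.
Unset Strict Implicit.
Unset Printing Implicit Defensive.

Import Order.TTheory GRing.Theory Num.Theory.

Local Open Scope classical_set_scope.
Local Open Scope ring_scope.
Local Open Scope complex_scope.

(* e(t) = exp(2 pi i t). *)
Definition expi2pi (R : realType) (t : R) : R[i] :=
  cos (2 * pi * t) +i* sin (2 * pi * t).

Definition dirichlet_character (R : realType) (q : nat) (chi : int -> R[i]) :
    Prop :=
  [/\ forall n : int, chi (n + q%:Z) = chi n,
      forall m n : int, chi (m * n) = chi m * chi n &
      forall n : int, chi n != 0 <-> coprimez n q%:Z].

Definition principal_character (R : realType) (q : nat) : int -> R[i] :=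
  fun n => (coprimez n q%:Z)%:R.

Definition int_window (R : realType) (N H : R) : set int :=
  [set n : int | N < n%:~R <= N + H].

(* The operator \sum_(n \in A) is junk (zero) on infinite supports; this lemma
   rules that case out for the sums over int_window. *)
Lemma finite_int_window (R : realType) (N H : R) :
  finite_set (int_window N H).
Proof.
pose m := `|Num.floor (N + H) - Num.floor N|%N.
apply: (@sub_finite_set _ _
  ((fun k : nat => Num.floor N + k%:Z) @` `I_m.+1)); last first.
  exact: finite_image.
move=> n /= /andP[Nn nNH].
have h1 : Num.floor N <= n.
  by rewrite -(ler_int R) (le_trans (floor_le _)) // ltW.
have h2 : n <= Num.floor (N + H) by rewrite floor_ge_int.
exists `|n - Num.floor N|%N; last first.
  rewrite gez0_abs ?subr_ge0//.
  by rewrite [LHS]addrC subrK.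
rewrite /= ltnS /m -lez_nat !gez0_abs ?lerB// ?subr_ge0//.
exact: le_trans h2.
Qed.

Definition mixed_sum (R : realType) (f : {poly R}) (chi : int -> R[i])
    (N H : R) : R[i] :=
  \sum_(n \in int_window N H) expi2pi f.[n%:~R] * chi n.

(* Main.v *)
Require Import Defs.
From HB Require Import structures.
From mathcomp Require Import all_boot all_order all_algebra all_field.
From mathcomp Require Import complex zify ring lra.
From mathcomp Require Import all_classical all_reals all_analysis.

Set Implicit Arguments.
Unset Strict Implicit.
Unset Printing Implicit Defensive.

Import Order.TTheory GRing.Theory Num.Theory.
Import numFieldNormedType.Exports.

Local Open Scope ring_scope.

(* Burgess's method. Let P = q^(1/(2r)). For a up to A = H / W, with W of size P,
   the substitution n -> n + a t (t < W) bounds A W |S| by the sum over pairs (a, n)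
   of T(n / a mod q), where T(x) dominates every sum over t < M of
   e(g(t)) chi(x + t) with deg g <= d and M <= W. The collisions
   n / a = n' / a' are few because A H << q, and Hoelder's inequality reduces
   everything to the 2r-th moment of T.
   Up to an Abel summation the phase g may be replaced by one of W^D
   grid polynomials (W^j values for its j-th coefficient), the maximum over M is
   removed by a dyadic decomposition, and for a fixed phase the moment is expanded
   into complete character sums, bounded by Weil's theorem.
   Weil's bound is proved over F_p(X): the L-function of the character is a
   polynomial whose inverse roots have power sums given by character sums over
   F_(p^k), and Stepanov's method in Bombieri's form bounds those sums by
   O(p^(k/2)) for even k, which forces the inverse roots to have modulus at most
   sqrt p. *)

(** * Stepanov's method *)

(** The size of [W] balances the two parts of the [2 r]-th moment: the degenerate tuples give
    [p W^r], Weil's bound gives [sqrt p * W^(2r)], and both have order [P^(3r)] when [W] has the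
    size of [P]. The condition on [H] says [H^2 < P q], which is what keeps [A K], of order
    [H^2 / P], below a multiple of [q]. The [W^D] grid phases cost a factor [P^D] under the [2 r]-th
    root; this is the origin of [D] in the exponent. The logarithms come from the maximal function
    ([L^(2r)]), from the number of dyadic levels ([L]) and from the collisions ([1 + ln A]):
    [2 r + 2] of them in all, at most [4 r]. On the side of Weil's bound, Stepanov's construction
    wants the cardinality of the field to be a square [R^2], so that raising twice to the [R]-th
    power is the identity. Only even extensions are therefore treated, and the bound on the inverse
    roots is obtained through their squares. *)

Lemma poly_family_dependent (F : fieldType) (I : finType) (P : I -> {poly F})
    (m : nat) :
  (forall i, size (P i) <= m)%N -> (m < #|I|)%N ->
  exists2 b : I -> F, (exists i, b i != 0) & \sum_i b i *: P i = 0.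
Proof.
move=> szP ltmI.
pose M : 'M[F]_(#|I|, m) := \matrix_(i, j) (P (enum_val i))`_j.
have kerN0 : kermx M != 0.
  rewrite kermx_eq0; apply/negP => /eqP rM.
  by have := rank_leq_col M; rewrite rM leqNgt ltmI.
have /rowV0Pn[v /sub_kermxP vM v0] := kerN0.
exists (fun i => v 0 (enum_rank i)).
  have [j vj] : exists j, v 0 j != 0.
    apply: contrapT => /forallNP nv; case/negP: v0; apply/eqP/rowP => j.
    by rewrite mxE; apply/eqP/negPn/negP; exact: nv.
  by exists (enum_val j); rewrite enum_valK.
apply/polyP => j; rewrite coef0 coef_sum.
have [ltjm|lemj] := ltnP j m; last first.
  by rewrite big1// => i _; rewrite coefZ nth_default ?mulr0// (leq_trans (szP i)).
have := congr1 (fun A : 'rV_m => A 0 (Ordinal ltjm)) vM.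
rewrite !mxE => vMj; rewrite -[RHS]vMj (reindex (fun i : 'I_#|I| => enum_val i))/=; last first.
  by apply: onW_bij; exact: enum_val_bij.
by apply: eq_bigr => i _; rewrite coefZ mxE enum_valK.
Qed.

(** Among the terms with nonzero [b i], the one of least order wins: after division by its power of
    [X - a] it alone survives evaluation at [a]. *)
Lemma poly_family_distinct_orders (F : fieldType) (I : finType) (a : F)
    (e : I -> nat) (V : I -> {poly F}) (b : I -> F) :
  injective e -> (forall i, (V i).[a] != 0) -> (exists i, b i != 0) ->
  \sum_i b i *: (('X - a%:P) ^+ e i * V i) != 0.
Proof.
move=> inje Va [i1 bi1].
case: (arg_minnP (P := fun i => b i != 0) e bi1) => i0 bi0 mini0.
have -> : \sum_i b i *: (('X - a%:P) ^+ e i * V i) =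
    ('X - a%:P) ^+ e i0 * \sum_i b i *: (('X - a%:P) ^+ (e i - e i0) * V i).
  rewrite mulr_sumr; apply: eq_bigr => i _.
  have [->|bi] := eqVneq (b i) 0; first by rewrite !scale0r mulr0.
  by rewrite -scalerAr mulrA -exprD subnKC// mini0.
rewrite mulf_neq0 ?expf_neq0 ?polyXsubC_eq0//.
apply/eqP => /(congr1 (fun P => P.[a])); apply/eqP.
rewrite horner_sum horner0 (bigD1 i0)//= big1 ?addr0.
  by rewrite hornerZ hornerM subnn expr0 hornerC mul1r mulf_neq0.
move=> i ii0; have [->|bi] := eqVneq (b i) 0; first by rewrite scale0r horner0.
rewrite hornerZ hornerM horner_exp hornerXsubC subrr expr0n subn_eq0.
rewrite leqNgt ltn_neqAle mini0// (inj_eq inje) eq_sym ii0/=.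
by rewrite mul0r mulr0.
Qed.

(* Bombieri's form of Stepanov's method. With [R ^ 2 = #|E|] and
   [j' = - j mod n], the terms [X^(i + R i') G^((j + R j') / n)] have distinct
   orders at the simple zero of [G], while at a point with
   [G ^ ((R ^ 2 - 1) / n) = c] their [R]-th powers take the values of
   [c^j' X^(R i + i') G^((R j + j') / n)]: a linear relation between the latter
   polynomials produces a nonzero polynomial vanishing at all these points. *)
Section Stepanov.
Variables (E : finFieldType) (p k n s : nat).
Let R := (p ^ k)%N.
Hypotheses (charE : p \in [pchar E]) (cardEQ : #|E| = (R ^ 2)%N).
Hypotheses (n_gt0 : (0 < n)%N) (Rns : R = (n * s).+1).
Variables (G U : {poly E}) (a c : E) (g : nat).
Hypotheses (G_simple : G = ('X - a%:P) * U) (Ua : U.[a] != 0).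
Hypotheses (sizeG : (size G <= g.+1)%N) (R_large : (4 + 2 * g < R)%N).

Let j' (j : nat) := ((n - j) %% n)%N.
(** Number of values of [i'], large enough for the [s * n * B] polynomials [Z2] to outnumber their
    [R s + B + g R] possible coefficients when [R > 4 + 2 g]. *)
Let B := (s + g + 3)%N.

Let j'_lt j : (j' j < n)%N. Proof. by rewrite ltn_mod. Qed.

Let j'_add j : (j < n)%N -> (n %| j + j' j)%N.
Proof.
by move=> ltjn; rewrite /dvdn modnDmr subnKC ?modnn// ltnW.
Qed.

(** [R] is 1 modulo [n], so the exponent is congruent to [j + j']. *)
Let dvd1 j : (j < n)%N -> (n %| j + R * j' j)%N.
Proof.
move=> ltjn; rewrite Rns mulSn addnA dvdn_addr ?j'_add//.
by rewrite -mulnA dvdn_mulr.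
Qed.

Let dvd2 j : (j < n)%N -> (n %| R * j + j' j)%N.
Proof.
move=> ltjn; rewrite Rns mulSn addnAC dvdn_addr ?j'_add//.
by rewrite -mulnA dvdn_mulr.
Qed.

Let I : finType := ('I_s * 'I_n * 'I_B)%type.
Let e1 (x : I) := ((x.1.2 + R * j' x.1.2) %/ n)%N.
Let e2 (x : I) := ((R * x.1.2 + j' x.1.2) %/ n)%N.
Let Z1 (x : I) : {poly E} := ('X - a%:P) ^+ (x.1.1 + R * x.2) * G ^+ e1 x.
Let Z2 (x : I) : {poly E} :=
  (c ^+ j' x.1.2) *: (('X - a%:P) ^+ (R * x.1.1 + x.2) * G ^+ e2 x).

Let n_le_R : (n <= R)%N.
Proof. by move: R_large; rewrite Rns; clear; case: (s) => [|s']; nia. Qed.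

Let e1_le x : (e1 x <= R)%N.
Proof.
rewrite /e1; have := ltn_ord x.1.2; have := j'_lt x.1.2.
rewrite leq_divLR ?dvd1//; move: (nat_of_ord _) (j' _) n_le_R => u v; clear; nia.
Qed.

Let e2_le x : (e2 x <= R)%N.
Proof.
rewrite /e2; have := ltn_ord x.1.2; have := j'_lt x.1.2.
rewrite leq_divLR ?dvd2//; move: (nat_of_ord _) (j' _) n_le_R => u v; clear; nia.
Qed.

Let size_GX m l :
  (size (('X - a%:P) ^+ m * G ^+ l)%R <= m + g * l + 1)%N.
Proof.
apply: (leq_trans (size_polyMleq _ _)); rewrite size_exp_XsubC.
have := size_poly_exp_leq G l; have : ((size G).-1 * l <= g * l)%N by rewrite leq_mul2r -subn1 leq_subLR sizeG orbT.
by move: ((size G).-1 * l)%N (g * l)%N (size (G ^+ l)); clear; lia.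
Qed.

(** [n] times the order is [(n i + j) + R (n i' + j')] with [n i + j < R]: reduction modulo [R]
    recovers [n i + j], hence [i] and [j], and then [i']. *)
Let e1_inj : injective (fun x : I => (x.1.1 + R * x.2 + e1 x)%N).
Proof.
move=> [[i j] l] [[i2 j2] l2] /=; rewrite /e1/= => H.
have E1 : (n * i + j + R * (n * l + j' j) =
           n * i2 + j2 + R * (n * l2 + j' j2))%N.
  have h1 := divnK (dvd1 (ltn_ord j)); have h2 := divnK (dvd1 (ltn_ord j2)).
  move: H h1 h2; move: (_ %/ n)%N (_ %/ n)%N => u v; clear; nia.
have lt1 (i1 : 'I_s) (j1 : 'I_n) : (n * i1 + j1 < R)%N.
  rewrite Rns; have := ltn_ord i1; have := ltn_ord j1; clear; nia.
have E2 : (n * i + j = n * i2 + j2)%N.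
  have := congr1 (modn^~ R) E1; rewrite !(addnC _ (R * _)%N) !(mulnC R).
  by rewrite !modnMDl !modn_small.
have Ej : j = j2 :> nat.
  have := congr1 (modn^~ n) E2; rewrite !(mulnC n) !modnMDl.
  by rewrite !modn_small.
have Ei : i = i2 :> nat.
  by move: E2 n_gt0; rewrite Ej; clear; nia.
have El : l = l2 :> nat by move: E1 n_gt0; rewrite -Ej -Ei Rns; clear; nia.
by congr (_, _, _); exact: val_inj.
Qed.

Lemma stepanov_bound :
  (n * #|[set x : E | G.[x] ^+ ((R ^ 2 - 1) %/ n) == c]%SET|
    <= R ^ 2 + n * (2 * g + 2) * R)%N.
Proof.
have R_gt0 : (0 < R)%N by rewrite Rns.
have cardI : #|I| = (s * n * B)%N by rewrite !card_prod !card_ord.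
have [b [i0 bi0] Hb] : exists2 b : I -> E, (exists i, b i != 0) &
    \sum_i b i *: Z2 i = 0.
  apply: (@poly_family_dependent _ _ _ (R * s + B + g * R)).
    move=> x; rewrite /Z2; apply: (leq_trans (size_scale_leq _ _)).
    apply: (leq_trans (size_GX _ _)).
    have := e2_le x; have := ltn_ord x.1.1; have := ltn_ord x.2; clear; nia.
  have : (s <= n * s)%N by rewrite leq_pmull.
  rewrite cardI /B (mulnC s n); move: R_large; rewrite Rns.
  by move: (n * s)%N => m; clear; nia.
(* The coefficients are [R]-th powers because a second [R]-th power restores them:
   [b ^+ (R ^ 2) = b] in [E]. *)
pose Z := \sum_x b x ^+ R *: Z1 x.
have pR : p.-nat R by rewrite pnatX pnat_id ?(pcharf_prime charE).
have RN : [pchar E].-nat R by rewrite (eq_pnat _ (pcharf_eq charE)).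
have Z0 : Z != 0.
  have -> : Z = \sum_x b x ^+ R *: (('X - a%:P) ^+ (x.1.1 + R * x.2 + e1 x)%N *
      U ^+ e1 x).
    by apply: eq_bigr => x _; rewrite /Z1 G_simple exprMn mulrA -exprD.
  apply: poly_family_distinct_orders => //.
    by move=> x; rewrite horner_exp expf_neq0.
  by exists i0; rewrite expf_neq0.
have sumR (J : finType) (F : J -> E) :
    (\sum_x F x) ^+ R = \sum_x F x ^+ R.
  elim/big_rec2: _ => [|x y z _ <-]; first by rewrite expr0n gtn_eqF.
  by rewrite exprDn_pchar.
set X0 := [set x : E | _]%SET.
have rootZ x : x \in X0 -> root Z x.
  rewrite inE => /eqP Gx; rewrite /root.
  suff : Z.[x] ^+ R == 0 by rewrite expf_eq0 => /andP[].
  rewrite -[X in _ == X](horner0 x) -Hb !horner_sum sumR; apply/eqP.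
  apply: eq_bigr => y _; rewrite /Z1 /Z2 !hornerZ !hornerM !horner_exp !hornerXsubC.
  have bR : (b y ^+ R) ^+ R = b y.
    by rewrite -exprM mulnn -cardEQ expf_card.
  rewrite exprMn bR; congr (_ * _).
  rewrite exprMn -!exprM mulrCA; congr (_ * _).
    have -> : ((y.1.1 + R * y.2) * R = R * y.1.1 + R ^ 2 * y.2)%N by nia.
    by rewrite !exprD; congr (_ * _); rewrite exprM -cardEQ expf_card.
  rewrite -Gx -exprM -exprD; congr (_ ^+ _).
  (* Multiplied by [n], the exponents of [G] agree: [(R ^ 2 - 1) j' + (R j + j') = R (j + R j')]. *)
  have nQ : (n %| R ^ 2 - 1)%N.
    rewrite Rns; apply/dvdnP; exists (s * (n * s + 2))%N; clear; nia.
  apply/eqP; rewrite -(eqn_pmul2r n_gt0) mulnDl.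
  rewrite [in X in _ == X + _]mulnAC (divnK nQ) (divnK (dvd2 (ltn_ord _))).
  rewrite mulnAC (divnK (dvd1 (ltn_ord _))).
  apply/eqP; have : ((R ^ 2 - 1).+1 = R ^ 2)%N by rewrite subn1 prednK// Rns expn_gt0.
  move: (R ^ 2 - 1)%N (nat_of_ord _) (j' _) => w u v; clear; nia.
have := max_poly_roots Z0 (rs := enum X0).
have -> : all (root Z) (enum X0).
  by apply/allP => x; rewrite mem_enum => /rootZ.
rewrite enum_uniq -cardE => /(_ isT isT) szZ.
have {szZ} : (#|X0| < s + R * (B - 1) + g * R + 1)%N.
  apply: (leq_trans szZ); apply: (leq_trans (size_sum _ _ _)).
  apply/bigmax_leqP => x _; apply: (leq_trans (size_scale_leq _ _)).
  apply: (leq_trans (size_GX _ _)).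
  have := e1_le x; have := ltn_ord x.1.1; have := ltn_ord x.2; clear; nia.
(* Since [n s (R + 1) = R ^ 2 - 1], the degree bound multiplied by [n] has main term [R ^ 2]. *)
rewrite /B; move: #|X0| => N; rewrite Rns; clear; nia.
Qed.
End Stepanov.

(** * Characteristic polynomials of elements of finite fields *)

Lemma monic_irreducible_factor (F : fieldType) (g : {poly F}) :
  (1 < size g)%N -> exists P, [/\ P \is monic, irreducible_poly P & P %| g].
Proof.
have [n] := ubnP (size g); elim: n g => // n IHn g szg g1.
have g0 : g != 0 by rewrite -size_poly_gt0 (leq_trans _ g1).
have [irrg|] := pselect (irreducible_poly g).
  exists ((lead_coef g)^-1 *: g); split; last by rewrite dvdpZl ?invr_eq0 ?lead_coef_eq0.
    by rewrite monicE lead_coefZ mulVf ?lead_coef_eq0.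
  have u0 : (lead_coef g)^-1 != 0 by rewrite invr_eq0 lead_coef_eq0.
  split; first by rewrite size_scale.
  move=> q q1; rewrite dvdpZr// => /(irrg.2 q q1) qg.
  by rewrite eqp_sym; apply: (eqp_trans (eqp_scale _ u0)); rewrite eqp_sym.
move=> nirr.
have [q [q1 qg qNg]] : exists q : {poly F}, [/\ size q != 1%N, q %| g & ~~ (q %= g)].
  apply: contrapT => nq; apply: nirr; split=> // q q1 qg.
  by apply: contrapT => /negP qNg; apply: nq; exists q.
have q0 : q != 0 by apply: contraNneq g0 => q0; rewrite q0 dvd0p in qg.
have szq : (size q < size g)%N.
  by rewrite ltn_neqAle (dvdp_leq g0 qg) andbT; apply: contraNneq qNg => szq;
    rewrite -(dvdp_size_eqp qg) szq.
have q2 : (1 < size q)%N by rewrite ltn_neqAle eq_sym q1 size_poly_gt0.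
have [P [mP iP Pq]] := IHn q (leq_trans szq szg) q2.
by exists P; split => //; exact: dvdp_trans qg.
Qed.

Lemma monic_irreducible_dvd_eq (F : fieldType) (P Q : {poly F}) :
  P \is monic -> irreducible_poly P -> Q \is monic -> irreducible_poly Q ->
  P %| Q -> P = Q.
Proof.
move=> mP iP mQ iQ PQ; apply/eqP; rewrite -eqp_monic//.
by apply: iQ.2 => //; rewrite neq_ltn iP.1 orbT.
Qed.

Lemma size_ltn_mul_irreducible (F : fieldType) (h P : {poly F}) :
  h != 0 -> irreducible_poly P -> (size h < size (h * P)%R)%N.
Proof.
move=> h0 iP; rewrite size_mul ?(irredp_neq0 iP)//.
by have := iP.1; case: (size P) => [|[|u]]// _; rewrite addnS /= addnS ltnS leq_addr.
Qed.

Lemma monic_one_irreducible_factor (F : fieldType) (P g : {poly F}) :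
  g \is monic -> P \is monic -> irreducible_poly P ->
  (forall Q, Q \is monic -> irreducible_poly Q -> Q %| g -> Q = P) ->
  exists e, g = P ^+ e.
Proof.
move=> mg mP iP; have [n] := ubnP (size g); elim: n g mg => // n IHn g mg szg allP.
have [g1|] := leqP (size g) 1.
  exists 0%N; rewrite expr0; apply/eqP; rewrite -eqp_monic ?monic1// -size_poly_eq1.
  by rewrite eqn_leq g1 size_poly_gt0 monic_neq0.
move=> /monic_irreducible_factor[Q [mQ iQ Qg]].
have QP := allP Q mQ iQ Qg; rewrite {}QP {mQ iQ} in Qg.
have /dvdpP[h gE] := Qg.
have mh : h \is monic by move: mg; rewrite gE monicMr.
have P0 := monic_neq0 mP; have h0 := monic_neq0 mh.
have [|S mS iS Sh|e hE] := IHn h mh.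
- by rewrite ltnS in szg; apply: leq_trans szg; rewrite gE size_ltn_mul_irreducible.
- by apply: allP => //; rewrite gE dvdp_mulr.
- by exists e.+1; rewrite gE hE exprSr.
Qed.

(** The field [L = F[X] / P] has [#|F| ^ deg P] elements, and the class of [X] is fixed by every
    iterate of the [#|L|]-th power map. *)
Lemma irreducible_dvd_card_Xn (F : finFieldType) (P : {poly F}) (e : nat) :
  P \is monic -> irreducible_poly P ->
  P %| 'X^(#|F| ^ ((size P).-1 * e))%N - 'X.
Proof.
move=> mP iP.
have hI : monic_irreducible_poly P by split.
pose L : finFieldType := {poly %/ P with hI}.
pose x : L := in_qpoly P 'X.
have cL : #|L| = (#|F| ^ (size P).-1)%N by rewrite card_qfpoly.
have xL : x ^+ (#|L| ^ e)%N = x.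
  elim: e => [|e IHe]; first by rewrite expn0 expr1.
  by rewrite expnSr exprM IHe expf_card.
rewrite expnM -cL.
have : in_qpoly P ('X^(#|L| ^ e)%N - 'X) = 0 :> {poly %/ P}.
  rewrite rmorphB rmorphXn /=; apply/eqP; rewrite subr_eq0; apply/eqP; exact: xL.
by move=> /val_eqP /=; rewrite -Pdiv.IdomainMonic.modpE ?(mk_monicE hI).
Qed.

Section FrobeniusCharPoly.
Variables (p : nat) (E : finFieldType) (i : nat) (em : {rmorphism 'F_p -> E}).
Hypotheses (pr_p : prime p) (cardE : #|E| = (p ^ i)%N).

Let charE : p \in [pchar E]. Proof. exact: card_finPcharP cardE pr_p. Qed.
Let phi : {rmorphism E -> E} := pFrobenius_aut charE.

Lemma em_expp a : em a ^+ p = em a.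
Proof. by rewrite -rmorphXn -[in X in _ ^+ X](card_Fp pr_p) expf_card. Qed.

Lemma em_exppn a t : em a ^+ (p ^ t)%N = em a.
Proof. by elim: t => // t IH; rewrite expnSr exprM IH em_expp. Qed.

Lemma expp_fixed z : z ^+ p = z -> exists a, z = em a.
Proof.
move=> zp; have := congr1 (fun q => (map_poly em q).[z]) (finField_genPoly 'F_p).
rewrite card_Fp// rmorphB rmorphXn /= map_polyX !hornerE zp subrr rmorph_prod.
rewrite horner_prod => /esym/eqP; rewrite prodf_seq_eq0 => /hasP[a _].
by rewrite /= map_polyXsubC hornerXsubC subr_eq0 => /eqP za; exists a.
Qed.

(** Inverse of [em] on its image, with default 0; it descends polynomials with Frobenius-fixed
    coefficients to ['F_p]. *)
Definition em_inv z := odflt 0 [pick a | em a == z].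

Lemma em_invK z : z ^+ p = z -> em (em_inv z) = z.
Proof.
move=> /expp_fixed[a ->]; rewrite /em_inv; case: pickP => [b /eqP//|/(_ a)].
by rewrite eqxx.
Qed.

Lemma emK a : em_inv (em a) = a.
Proof. by apply: (fmorph_inj em); rewrite em_invK ?em_expp. Qed.

Definition conj_poly (x : E) : {poly E} := \prod_(0 <= t < i) ('X - (x ^+ (p ^ t)%N)%:P).
(* The characteristic polynomial over 'F_p of the multiplication by [x] in [E]. *)
Definition charpolyF (x : E) : {poly 'F_p} := map_poly em_inv (conj_poly x).

(** Frobenius permutes the factors cyclically, because [x ^+ (p ^ i) = x]. *)
Lemma conj_poly_fixed x : map_poly phi (conj_poly x) = conj_poly x.
Proof.
rewrite rmorph_prod /=.
under eq_bigr do rewrite map_polyXsubC /= pFrobenius_autE -exprM -expnSr.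
rewrite /conj_poly; case: i cardE => [|m] cE; first by rewrite !big_geq.
rewrite big_nat_recr//= big_nat_recl//= mulrC expn0 expr1; congr (('X - _%:P) * _).
by rewrite -cE expf_card.
Qed.

Lemma charpolyFE x : map_poly em (charpolyF x) = conj_poly x.
Proof.
have inv0 : em_inv 0 = 0 by rewrite -(rmorph0 em) emK.
apply/polyP => k; rewrite coef_map /= coef_map_id0// em_invK//.
by rewrite -pFrobenius_autE -(coef_map phi) conj_poly_fixed.
Qed.

Lemma size_conj_poly x : size (conj_poly x) = i.+1.
Proof. by rewrite size_prod_XsubC size_iota subn0. Qed.

Lemma size_charpolyF x : size (charpolyF x) = i.+1.
Proof. by rewrite -(size_conj_poly x) -charpolyFE size_map_poly. Qed.

Lemma charpolyF_monic x : charpolyF x \is monic.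
Proof. by rewrite -(map_monic em) charpolyFE monic_prod_XsubC. Qed.

(** The right-hand side is the norm of [em a - x] from [E] to ['F_p]; through it, characters of
    ['F_p] at values of [charpolyF] become characters of [E]. *)
Lemma charpolyF_eval x a :
  em (charpolyF x).[a] = (em a - x) ^+ (\sum_(0 <= t < i) p ^ t)%N.
Proof.
rewrite -horner_map /= charpolyFE horner_prod; under eq_bigr do rewrite hornerXsubC.
rewrite expr_sum; apply: eq_bigr => t _.
have pt : [pchar E].-nat (p ^ t)%N.
  by rewrite (eq_pnat _ (pcharf_eq charE)) pnatX pnat_id.
by rewrite exprDn_pchar// exprNn_pchar// em_exppn.
Qed.

Lemma horner_expp (g : {poly 'F_p}) z :
  (map_poly em g).[z ^+ p] = (map_poly em g).[z] ^+ p.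
Proof.
rewrite -!(pFrobenius_autE charE) -horner_map /=; congr (_.[_]).
rewrite -map_poly_comp; apply: eq_map_poly => a /=.
by rewrite pFrobenius_autE em_expp.
Qed.

Lemma root_exppn (g : {poly 'F_p}) z t :
  root (map_poly em g) (z ^+ (p ^ t)%N) = root (map_poly em g) z.
Proof.
elim: t => [|t IH]; first by rewrite expn0 expr1.
by rewrite -IH expnSr exprM /root horner_expp expf_eq0 prime_gt0.
Qed.

Lemma irreducible_dvd_root (P g : {poly 'F_p}) z :
  irreducible_poly P -> root (map_poly em P) z ->
  (P %| g) = root (map_poly em g) z.
Proof.
move=> iP Pz; apply/idP/idP => [Pg|gz].
  by apply: root_dvdp Pz; rewrite dvdp_map.
apply/negPn/negP => nPg; have := irreducible_poly_coprime g iP; rewrite nPg.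
rewrite -(coprimep_map em) => /coprimep_root /(_ Pz).
by rewrite (rootP gz) eqxx.
Qed.

Lemma root_charpolyF x : (0 < i)%N -> root (map_poly em (charpolyF x)) x.
Proof.
move=> i_gt0; rewrite charpolyFE /root /conj_poly big_ltn// expn0 expr1 hornerM.
by rewrite hornerXsubC subrr mul0r.
Qed.

Lemma minpoly_exists x : (0 < i)%N ->
  exists P : {poly 'F_p}, [/\ P \is monic, irreducible_poly P & root (map_poly em P) x].
Proof.
move=> i_gt0; have := root_charpolyF x i_gt0; move: (charpolyF x) (charpolyF_monic x) => g.
have [n] := ubnP (size g); elim: n g => // n IHn g szg mg gx.
have g1 : (1 < size g)%N.
  rewrite -(size_map_poly em) (root_size_gt1 _ gx)//.
  by rewrite map_poly_eq0 monic_neq0.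
have [P [mP iP /dvdpP[h gE]]] := monic_irreducible_factor g1.
have mh : h \is monic by move: mg; rewrite gE monicMr.
move: gx; rewrite gE rmorphM rootM => /orP[hx|Px]; last by exists P.
apply: (IHn h) => //; rewrite ltnS in szg; apply: leq_trans szg.
by rewrite gE size_ltn_mul_irreducible ?monic_neq0.
Qed.

(** Over [E], [Q] must vanish at some conjugate of [x]; having coefficients in ['F_p], it then
    vanishes at [x] itself. *)
Lemma charpolyF_irreducible_factor (x : E) (P Q : {poly 'F_p}) :
  P \is monic -> irreducible_poly P -> root (map_poly em P) x ->
  Q \is monic -> irreducible_poly Q -> Q %| charpolyF x -> Q = P.
Proof.
move=> mP iP Px mQ iQ; rewrite -(dvdp_map em) charpolyFE.
move=> /(@dvdp_prod_XsubC _ _ _ (fun t => x ^+ (p ^ t)%N))[m].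
case: (mask m _) => [|t r] Qr.
  have := iQ.1; rewrite -(size_map_poly em) (eqp_size Qr) big_nil size_poly1.
  by rewrite ltnn.
have Qx : root (map_poly em Q) x.
  rewrite -(root_exppn _ _ t) (eqp_root Qr) big_cons rootM root_XsubC eqxx//.
by apply/esym/monic_irreducible_dvd_eq => //; rewrite (irreducible_dvd_root _ iP Px).
Qed.

Lemma charpolyF_power (x : E) (P : {poly 'F_p}) :
  P \is monic -> irreducible_poly P -> root (map_poly em P) x ->
  exists2 e, charpolyF x = P ^+ e & ((size P).-1 * e = i)%N.
Proof.
move=> mP iP Px.
have [e cE] : exists e, charpolyF x = P ^+ e.
  apply: monic_one_irreducible_factor => //; first exact: charpolyF_monic.
  by move=> Q; exact: charpolyF_irreducible_factor.
exists e => //.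
by rewrite -size_exp -cE size_charpolyF.
Qed.

(** [P] divides [X^#|E| - X], so it splits over [E] with distinct roots. *)
Lemma card_roots_irreducible (P : {poly 'F_p}) (e : nat) :
  P \is monic -> irreducible_poly P -> ((size P).-1 * e = i)%N ->
  #|[set x : E | root (map_poly em P) x]%SET| = (size P).-1.
Proof.
move=> mP iP eE.
have : map_poly em P %| \prod_(x : E) ('X - x%:P).
  rewrite -finField_genPoly cardE -eE.
  have := irreducible_dvd_card_Xn e mP iP; rewrite -(dvdp_map em) card_Fp//.
  by rewrite rmorphB rmorphXn /= map_polyX.
move=> /(@dvdp_prod_XsubC _ _ _ id)[m Pm].
have uniqm : uniq (mask m (index_enum E)) by rewrite mask_uniq// index_enum_uniq.
rewrite -(size_map_poly em) (eqp_size Pm) size_prod_XsubC /= -(card_uniqP uniqm).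
apply: eq_card => x; rewrite inE (eqp_root Pm).
by rewrite root_prod_XsubC.
Qed.
End FrobeniusCharPoly.

(** * Logarithmic derivative of the L-function over ['F_p] *)

Section CountCharPoly.
Variables (p : nat) (pr_p : prime p) (E : nat -> finFieldType).
Variable em : forall k, {rmorphism 'F_p -> E k}.
Hypothesis cardEk : forall k, (0 < k)%N -> #|E k| = (p ^ k)%N.

Local Notation cp k x := (@charpolyF p (E k) k (em k) x).
Local Notation ndvd k g := #|[set x : E k | (cp k x %| g)%R]%SET|.

(** With [v] the multiplicity of [P] in [h], the new elements are those whose characteristic
    polynomial is exactly [P ^+ v.+1]: the roots of [P], at the single level [k = deg P * v.+1]. *)
Lemma card_charpoly_dvd_mul k (P h : {poly 'F_p}) (v : nat) :
  (0 < k)%N -> P \is monic -> irreducible_poly P ->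
  P ^+ v %| h -> ~~ (P ^+ v.+1 %| h) ->
  ndvd k (h * P) =
  (ndvd k h +
   if k == (size P).-1 * v.+1 then (size P).-1 else 0)%N.
Proof.
move=> k_gt0 mP iP Pvh PNh; have cE := cardEk k_gt0.
set A := [set x | _ %| h * P]%SET; set B := [set x | _ %| h]%SET.
have d_gt0 : (0 < (size P).-1)%N by have := iP.1; case: (size P) => [|[]].
have P0 := monic_neq0 mP.
rewrite -(cardsID B A); congr (_ + _)%N.
  congr #|pred_of_set _|; apply/finset.setIidPr/fintype.subsetP => x; rewrite !inE => xh.
  exact: dvdp_mulr.
have powh e : (P ^+ e %| h) = (e <= v)%N.
  apply/idP/idP => [Peh|ev]; last exact: dvdp_trans (dvdp_exp2l _ ev) Pvh.
  rewrite leqNgt; apply: contra PNh => ve; exact: dvdp_trans (dvdp_exp2l _ ve) Peh.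
have powhP e : (P ^+ e %| h * P) = (e <= v.+1)%N.
  case: e => [|e]; first by rewrite expr0 dvd1p.
  by rewrite exprSr dvdp_mul2r// powh.
have ABE : (A :\: B)%SET = [set x : E k | root (map_poly (em k) P) x &
    k == (size P).-1 * v.+1]%SET.
  apply/setP => x; rewrite !inE.
  have [Px|nPx] := boolP (root _ x).
    have [e -> kE] := charpolyF_power pr_p cE mP iP Px.
    rewrite powh powhP -[in RHS]kE eqn_pmul2l// -ltnNge andbC.
    by rewrite eqn_leq.
  suff -> : (cp k x %| h * P) = (cp k x %| h) by rewrite andNb.
  apply: Gauss_dvdpl; rewrite coprimep_sym irreducible_poly_coprime//.
  apply: contra nPx => /dvdpP[g cpE].
  have [Q [mQ iQ Qx]] := minpoly_exists (em k) pr_p cE x k_gt0.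
  suff <- : Q = P by [].
  by apply/esym; apply: (charpolyF_irreducible_factor pr_p cE mQ iQ Qx) => //;
    rewrite cpE dvdp_mull.
rewrite ABE; case: ifPn => kE.
  rewrite -(card_roots_irreducible (em k) pr_p cE mP iP (esym (eqP kE))).
  by apply: eq_card => x; rewrite !inE andbT.
by apply: eq_card0 => x; rewrite !inE andbF.
Qed.

(** Analogue of the identity expressing [log n] as the sum of the von Mangoldt function over the
    divisors of [n], with the degree as logarithm. Every irreducible factor, counted with
    multiplicity, contributes its degree at one level. *)
Lemma count_charpoly_dvd (g : {poly 'F_p}) (M : nat) :
  g \is monic -> ((size g).-1 <= M)%N ->
  (\sum_(1 <= k < M.+1) ndvd k g = (size g).-1)%N.
Proof.
have [n] := ubnP (size g); elim: n g => // n IHn g szg mg gM.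
have [g1|] := leqP (size g) 1.
  have szg1 : size g = 1%N by apply/eqP; rewrite eqn_leq g1 size_poly_gt0 monic_neq0.
  rewrite szg1 /= big_nat big1// => k /andP[k_gt0 _]; apply: eq_card0 => x.
  rewrite !inE; apply/negP => /(dvdp_leq (monic_neq0 mg)).
  by rewrite size_charpolyF ?cardEk// szg1 ltnS leqNgt k_gt0.
move=> /monic_irreducible_factor[P [mP iP /dvdpP[h gE]]].
have mh : h \is monic by move: mg; rewrite gE monicMr.
have d_gt0 : (0 < (size P).-1)%N by have := iP.1; case: (size P) => [|[]].
have h0 := monic_neq0 mh; have P0 := monic_neq0 mP.
have exv : exists v, P ^+ v %| h by exists 0%N; rewrite expr0 dvd1p.
have bdv v : P ^+ v %| h -> (v <= size h)%N.
  move=> /(dvdp_leq h0); apply: leq_trans.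
  rewrite -[X in (_ <= X)%N]prednK ?size_poly_gt0 ?expf_neq0// size_exp.
  by rewrite ltnW// ltnS leq_pmull.
case: (ex_maxnP exv bdv) => v Pvh maxv.
have PNh : ~~ (P ^+ v.+1 %| h) by apply/negP => /maxv; rewrite ltnn.
have szgE : (size g).-1 = ((size h).-1 + (size P).-1)%N.
  rewrite gE size_mul//; move: h0 P0; rewrite -!size_poly_gt0.
  by case: (size h) => // a; case: (size P) => // b _ _; rewrite addnS.
rewrite (eq_big_nat _ _ (F2 := fun k => ndvd k h +
   if k == (size P).-1 * v.+1 then (size P).-1 else 0)%N); last first.
  move=> k /andP[k_gt0 _]; rewrite gE.
  exact: card_charpoly_dvd_mul.
rewrite big_split /= IHn//; last 2 first.
- by rewrite ltnS in szg; apply: leq_trans szg; rewrite gE size_ltn_mul_irreducible.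
- by apply: leq_trans gM; rewrite szgE leq_addr.
rewrite szgE; congr (_ + _)%N.
rewrite -big_mkcond /= -(big_filter _ (fun k => k == _)).
rewrite (@filter_pred1_uniq _ _ ((size P).-1 * v.+1)%N) ?iota_uniq ?big_seq1//.
rewrite mem_index_iota muln_gt0 d_gt0 /= ltnS (leq_trans _ gM)// szgE mulnSr.
rewrite leq_add2r -size_exp -!subn1 leq_sub2r// dvdp_leq//.
Qed.

Section Newton.
Variables (C : comNzRingType) (Lam : {poly 'F_p} -> C).
Hypothesis LamM : forall g h, Lam (g * h) = Lam g * Lam h.

(** Coefficient of [T^m] in the L-function of [Lam]; [u] carries the coefficients below [X^m]. *)
Definition monic_sum (m : nat) : C := \sum_(u : {poly_m 'F_p}) Lam ('X^m + polyn u).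
Definition ext_sum (k : nat) : C := \sum_(x : E k) Lam (cp k x).

Lemma size_Xn_add (m : nat) (u : {poly_m 'F_p}) :
  size ('X^m + polyn u) = m.+1 /\ 'X^m + polyn u \is monic.
Proof.
have szu : (size (polyn u) < size ('X^m : {poly 'F_p}))%N.
  by rewrite size_polyXn ltnS size_npoly.
by rewrite size_polyDl// monicE lead_coefDl// size_polyXn lead_coefXn.
Qed.

Lemma Xn_add_npolyp (m : nat) (g : {poly 'F_p}) :
  g \is monic -> size g = m.+1 -> 'X^m + polyn (npolyp m (g - 'X^m)) = g.
Proof.
move=> mg szg.
have szd : (size (g - 'X^m)%R <= m)%N.
  apply/leq_sizeP => j; rewrite leq_eqVlt => /orP[/eqP <-|mj].
    rewrite coefB coefXn eqxx; move: mg; rewrite monicE lead_coefE szg => /eqP ->.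
    by rewrite subrr.
  by rewrite coefB coefXn gtn_eqF// subr0 nth_default// szg.
by rewrite npolypK// addrC subrK.
Qed.

Lemma sum_monic_multiples (m k : nat) (P : {poly 'F_p}) :
  (k <= m)%N -> P \is monic -> size P = k.+1 ->
  \sum_(u : {poly_m 'F_p} | P %| 'X^m + polyn u) Lam ('X^m + polyn u) =
  Lam P * monic_sum (m - k).
Proof.
move=> km mP szP; have P0 := monic_neq0 mP.
pose h (w : {poly_(m - k) 'F_p}) := npolyp m (P * ('X^(m - k) + polyn w) - 'X^m).
pose h' (u : {poly_m 'F_p}) := npolyp (m - k) (('X^m + polyn u) %/ P - 'X^(m - k)).
have hE w : 'X^m + polyn (h w) = P * ('X^(m - k) + polyn w).
  have [szw mw] := size_Xn_add w.
  rewrite Xn_add_npolyp ?monicMl// size_mul ?monic_neq0// szw szP.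
  by rewrite addSn addnS /= subnKC.
have h'K u : P %| 'X^m + polyn u -> h (h' u) = u.
  have [szu mu] := size_Xn_add u; move=> /dvdpP[g gE].
  have mg : g \is monic by move: mu; rewrite gE monicMr.
  have szg : size g = (m - k).+1.
    move: szu; rewrite gE size_mul ?monic_neq0// szP addnS /= => szg.
    by rewrite -subSn// -szg addnK.
  apply: val_inj; apply: (addrI 'X^m); rewrite hE /h' Xn_add_npolyp gE ?mulpK//.
  by rewrite mulrC.
rewrite (reindex_onto h h') //= /monic_sum mulr_sumr; apply: eq_big => w.
  rewrite hE dvdp_mulIl /=; apply/eqP/val_inj; apply: (addrI 'X^(m - k)).
  have [szw mw] := size_Xn_add w.
  by rewrite /h' hE mulKp// Xn_add_npolyp.
by move=> _; rewrite hE LamM.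
Qed.

(* The logarithmic derivative of the L-function: [m] is the number of pairs
   [(k, x)] such that the characteristic polynomial of [x : E k] divides a given
   monic polynomial of degree [m]. *)
Lemma newton_identity (m : nat) :
  m%:R * monic_sum m = \sum_(1 <= k < m.+1) ext_sum k * monic_sum (m - k).
Proof.
rewrite /monic_sum mulr_sumr.
transitivity (\sum_(u : {poly_m 'F_p}) \sum_(1 <= k < m.+1)
    \sum_(x : E k | cp k x %| 'X^m + polyn u) Lam ('X^m + polyn u)).
  apply: eq_bigr => u _; have [szu mu] := size_Xn_add u.
  have cnt := @count_charpoly_dvd _ m mu; rewrite szu /= in cnt.
  rewrite -[X in X%:R](cnt (leqnn m)) natr_sum mulr_suml.
  apply: eq_bigr => k _; rewrite -sumr_const mulr_suml.
  by apply: eq_big => [x|x _]; rewrite ?inE ?mul1r.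
rewrite exchange_big /=; apply: eq_big_nat => k /andP[k_gt0 km].
rewrite (exchange_big_dep xpredT) //= /ext_sum mulr_suml; apply: eq_bigr => x _.
apply: sum_monic_multiples => //; first by apply: charpolyF_monic => //; exact: cardEk.
by apply: size_charpolyF => //; exact: cardEk.
Qed.
End Newton.
End CountCharPoly.

(** * Vanishing of the L-function coefficients of high degree *)

Section MonicSumVanish.
Variables (p : nat) (pr_p : prime p) (C : numFieldType) (chi : 'F_p -> C).
Hypothesis chiM : forall x y, chi (x * y) = chi x * chi y.
Hypothesis chi_sum0 : \sum_x chi x = 0.
Variables (e : 'F_p -> nat) (a : 'F_p).
Hypothesis ea : e a = 1%N.

Definition poly_char (g : {poly 'F_p}) : C := chi (\prod_b g.[b] ^+ e b).

Lemma poly_charM g h : poly_char (g * h) = poly_char g * poly_char h.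
Proof.
rewrite /poly_char -chiM -big_split /=; congr chi.
by apply: eq_bigr => b _; rewrite hornerM exprMn.
Qed.

(** Let [h] vanish on the support of [e] except at [a]. Adding [l *: h] permutes the monic
    polynomials of degree [m] and, on the support, changes only the value at [a]. That value runs
    through ['F_p] with [l] and enters with exponent 1, so averaging over [l] brings in
    [\sum_x chi x = 0]. *)
Lemma monic_sum_eq0 m : (#|[set b | (0 < e b)%N]%SET| <= m)%N ->
  monic_sum poly_char m = 0.
Proof.
move=> sm.
pose h : {poly 'F_p} := \prod_(b in [set b | (0 < e b)%N & b != a]%SET) ('X - b%:P).
have hm : (size h <= m)%N.
  apply: leq_trans sm; rewrite /h -big_enum size_prod_XsubC -cardE.
  rewrite [X in (_ < #|pred_of_set X|)%N](_ : _ = a |: [set b | (0 < e b)%N & b != a])%SET.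
    by rewrite cardsU1 !inE eqxx andbF.
  apply/setP => b; rewrite !inE; have [->|] := eqVneq b a; first by rewrite ea.
  by rewrite andbT.
have ha : h.[a] != 0.
  rewrite horner_prod prodf_seq_neq0; apply/allP => b _; apply/implyP.
  by rewrite inE hornerXsubC subr_eq0 eq_sym => /andP[].
have hb b : (0 < e b)%N -> b != a -> h.[b] = 0.
  move=> eb ba; rewrite horner_prod (bigD1 b) ?inE ?eb//= hornerXsubC subrr.
  by rewrite mul0r.
have shift (l : 'F_p) : monic_sum poly_char m =
    \sum_(u : {poly_m 'F_p}) poly_char ('X^m + polyn u + l *: h).
  rewrite /monic_sum (reindex_inj (addIr (npolyp m (l *: h)))) /=.
  apply: eq_bigr => u _; congr poly_char; rewrite -addrA; congr (_ + _).
  by rewrite npolypK// (leq_trans (size_scale_leq _ _)).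
have p0 : p%:R != 0 :> C by rewrite pnatr_eq0 -lt0n prime_gt0.
apply: (mulfI p0); rewrite mulr0.
transitivity (\sum_(l : 'F_p) monic_sum poly_char m).
  by rewrite sumr_const card_Fp// mulr_natl.
under eq_bigr => l _ do rewrite (shift l).
rewrite exchange_big big1//= => u _; set g := 'X^m + polyn u.
transitivity (chi (\prod_(b | b != a) g.[b] ^+ e b) *
    \sum_(l : 'F_p) chi (g.[a] + l * h.[a])).
  rewrite mulr_sumr; apply: eq_bigr => l _; rewrite -chiM /poly_char; congr chi.
  rewrite (bigD1 a)//= mulrC ea expr1 hornerD hornerZ; congr (_ * _).
  apply: eq_bigr => b ba; have [->|eb] := posnP (e b); first by rewrite !expr0.
  by rewrite hornerD hornerZ hb// mulr0 addr0.
suff -> : \sum_(l : 'F_p) chi (g.[a] + l * h.[a]) = \sum_x chi x.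
  by rewrite chi_sum0 mulr0.
rewrite [RHS](reindex (fun l => g.[a] + l * h.[a])) //=.
exists (fun x => (x - g.[a]) / h.[a]) => x _ /=.
  by rewrite addrAC subrr add0r mulfK.
by rewrite mulfVK// addrC subrK.
Qed.
End MonicSumVanish.

(** * Power sums *)

Section PowerSums.
Variable C : numClosedFieldType.

Lemma newton_power_sums (al : seq C) (m : nat) :
  let L : {poly C} := \prod_(z <- al) (1 - z *: 'X) in
  m%:R * L`_m = - \sum_(1 <= k < m.+1) (\sum_(z <- al) z ^+ k) * L`_(m - k).
Proof.
elim: al m => [|z al IH] m /=.
  rewrite big_nil coef1; have [->|m0] := eqVneq m 0%N; first by rewrite mul0r big_geq ?oppr0.
  rewrite mulr0 big1 ?oppr0// => k _.
  by rewrite big_nil mul0r.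
case: m => [|m]; first by rewrite mul0r big_geq ?oppr0.
rewrite big_cons; set L := \prod_(_ <- _) _ in IH *.
have coefL k : ((1 - z *: 'X) * L)`_k.+1 = L`_k.+1 - z * L`_k.
  by rewrite mulrBl mul1r coefB -scalerAl coefZ coefXM.
have coefL0 : ((1 - z *: 'X) * L)`_0 = L`_0.
  by rewrite mulrBl mul1r coefB -scalerAl coefZ coefXM /= mulr0 subr0.
rewrite coefL.
have -> : \sum_(1 <= k < m.+2) (\sum_(y <- z :: al) y ^+ k) *
      ((1 - z *: 'X) * L)`_(m.+1 - k) =
    \sum_(1 <= k < m.+2) (\sum_(y <- al) y ^+ k) * L`_(m.+1 - k)
    - z * (\sum_(1 <= k < m.+1) (\sum_(y <- al) y ^+ k) * L`_(m - k))
    + \sum_(1 <= k < m.+2) z ^+ k * L`_(m.+1 - k)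
    - z * (\sum_(1 <= k < m.+1) z ^+ k * L`_(m - k)).
  rewrite !(@big_nat_recr _ _ _ m.+1 1)//= subnn coefL0 big_cons.
  rewrite (eq_big_nat _ _ (F2 := fun k =>
     ((\sum_(y <- al) y ^+ k) * L`_(m.+1 - k) - z * ((\sum_(y <- al) y ^+ k) * L`_(m - k)))
     + (z ^+ k * L`_(m.+1 - k) - z * (z ^+ k * L`_(m - k))))); last first.
    move=> k /andP[k0 km]; rewrite big_cons subSn// coefL; ring.
  rewrite big_split /= !sumrB -!mulr_sumr; ring.
rewrite [X in _ + X - _](big_nat_recl) //=.
rewrite [in X in _ - X]mulr_sumr.
rewrite (eq_big_nat _ _ (F1 := fun i => z ^+ i.+1 * L`_(m.+1 - i.+1))
   (F2 := fun i => z * (z ^+ i * L`_(m - i)))); last first.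
  by move=> k _; rewrite subSS exprS mulrA.
rewrite expr1 subSS subn0.
have := IH m.+1; have := IH m => /=; rewrite -natr1 => E1 E2.
have -> : \sum_(1 <= k < m.+2) (\sum_(y <- al) y ^+ k) * L`_(m.+1 - k) =
    - ((m%:R + 1) * L`_m.+1) by rewrite E2 opprK.
have -> : \sum_(1 <= k < m.+1) (\sum_(y <- al) y ^+ k) * L`_(m - k) =
    - (m%:R * L`_m) by rewrite E1 opprK.
ring.
Qed.

(** Take for [al] the inverse roots of the polynomial with coefficients [c]. Minus their power sums
    obey the same recurrence, which determines [S] because [S k] occurs in it with coefficient
    [c 0 = 1]. *)
Lemma newton_solution (s : nat) (c S : nat -> C) :
  c 0%N = 1 -> (forall m, (s < m)%N -> c m = 0) ->
  (forall m, m%:R * c m = \sum_(1 <= k < m.+1) S k * c (m - k)%N) ->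
  exists2 al : seq C, (size al <= s)%N &
    forall k, (0 < k)%N -> S k = - \sum_(z <- al) z ^+ k.
Proof.
move=> c0 cs cS; pose L : {poly C} := \poly_(m < s.+1) c m.
have coefL m : L`_m = c m.
  by rewrite coef_poly ltnS; case: leqP => // /cs.
have L0 : L != 0.
  by apply/eqP => /polyP/(_ 0%N); rewrite coefL coef0 c0 => /eqP; rewrite oner_eq0.
have [zs LE] := closed_field_poly_normal L.
have zs0 z : z \in zs -> z != 0.
  move=> zin; apply/eqP => z0; have : root L 0.
    by rewrite LE rootZ ?lead_coef_eq0// root_prod_XsubC -z0.
  by rewrite /root horner_coef0 coefL c0 oner_eq0.
pose al := [seq z^-1 | z <- zs].
have LE' : L = \prod_(z <- al) (1 - z *: 'X).
  pose u := lead_coef L * \prod_(z <- zs) (- z).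
  have LE2 : L = u *: \prod_(z <- al) (1 - z *: 'X).
    rewrite [LHS]LE /u -scalerA; congr (_ *: _).
    rewrite /al big_map -mul_polyC rmorph_prod -big_split /= big_seq [RHS]big_seq.
    apply: eq_bigr => z zin.
    rewrite mulrBr mulr1 rmorphN /= mulNr opprK mul_polyC scalerA mulfV ?zs0//.
    by rewrite scale1r addrC.
  have : L`_0 = 1 by rewrite coefL.
  rewrite {1}LE2 coefZ -horner_coef0 horner_prod big1 ?mulr1.
    by move=> u1; rewrite LE2 u1 scale1r.
  by move=> z _; rewrite hornerD hornerN hornerZ hornerX mulr0 subr0 hornerC.
exists al.
  rewrite size_map -ltnS -(size_prod_XsubC _ id) -(size_scale _ (a := lead_coef L)).
    by rewrite -LE size_poly.
  by rewrite lead_coef_eq0.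
move=> k; elim/ltn_ind: k => k IH k0.
have := newton_power_sums al k; rewrite /= -LE' coefL cS.
case: k IH k0 => // k IH _.
rewrite !(@big_nat_recr _ _ _ k.+1 1)//= subnn coefL c0 !mulr1.
rewrite opprD.
rewrite (eq_big_nat _ _ (F1 := fun i => S i * c (k.+1 - i)%N)
  (F2 := fun i => - ((\sum_(z <- al) z ^+ i) * L`_(k.+1 - i)))); last first.
  by move=> i /andP[i0 ik]; rewrite IH// coefL mulNr.
by rewrite sumrN => /addrI.
Qed.

(** [P] vanishes at the other elements and [u] is the multiplicity of [b0] times [P.[b0]]. A growth
    bound on the power sums thus passes to each single element. *)
Lemma power_sum_interpolation (be : seq C) (b0 : C) : b0 \in be ->
  exists (P : {poly C}) (u : C), u != 0 /\ forall k,
   u * b0 ^+ k = \sum_(t < size P) P`_t * \sum_(b <- be) b ^+ (k + t).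
Proof.
move=> b0in; pose P : {poly C} := \prod_(b <- undup be | b != b0) ('X - b%:P).
exists P; exists ((count_mem b0 be)%:R * P.[b0]); split.
  rewrite mulf_neq0 ?pnatr_eq0 -?lt0n -?has_count ?has_pred1//.
  rewrite horner_prod prodf_seq_neq0; apply/allP => b _; apply/implyP.
  by rewrite hornerXsubC subr_eq0 eq_sym.
move=> k; under eq_bigr do rewrite mulr_sumr.
rewrite exchange_big /=.
transitivity (\sum_(b <- be) b ^+ k * P.[b]).
  rewrite (bigID (pred1 b0)) /= [X in _ + X]big1_seq ?addr0; last first.
    move=> b /andP[bb0 bin]; rewrite horner_prod big_mkcond.
    rewrite (bigD1_seq b) ?undup_uniq ?mem_undup//= bb0.
    by rewrite hornerXsubC subrr mul0r mulr0.
  rewrite (eq_bigr (fun => b0 ^+ k * P.[b0])); last by move=> b /eqP ->.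
  by rewrite big_const_seq iter_addr_0 -[RHS]mulr_natl [b0 ^+ k * _]mulrC mulrA.
apply: eq_bigr => b _; rewrite horner_coef mulr_sumr; apply: eq_bigr => t _.
by rewrite exprD mulrCA.
Qed.
End PowerSums.

(** * Weil's bound *)

Section ComplexModulus.
Variable R : realType.
Implicit Types z w : R[i]%C.

(** The norm of [R[i]] is [R[i]]-valued; [cabs] brings it back to [R]. *)
Definition cabs z : R := complex.Re `|z|.

Lemma cabsE z : `|z| = ((cabs z)%:C)%C.
Proof. by rewrite RRe_real// normr_real. Qed.

Lemma cabs_leC z (x : R) : (cabs z <= x) = (`|z| <= (x%:C)%C).
Proof. by rewrite cabsE lecR. Qed.

Lemma cabs_ge0 z : 0 <= cabs z.
Proof. by rewrite -ler0c -cabsE. Qed.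

Lemma cabs_inj_real z (x : R) : `|z| = (x%:C)%C -> cabs z = x.
Proof. by rewrite /cabs => ->. Qed.

Lemma cabsM z w : cabs (z * w) = cabs z * cabs w.
Proof. by apply: cabs_inj_real; rewrite normrM !cabsE rmorphM. Qed.

Lemma cabsN z : cabs (- z) = cabs z.
Proof. by rewrite /cabs normrN. Qed.

Lemma cabs0 : cabs 0 = 0.
Proof. by apply: cabs_inj_real; rewrite normr0. Qed.

Lemma cabs1 : cabs 1 = 1.
Proof. by apply: cabs_inj_real; rewrite normr1. Qed.

Lemma cabsX z n : cabs (z ^+ n) = cabs z ^+ n.
Proof. by elim: n => [|n IH]; rewrite ?expr0 ?cabs1// !exprS cabsM IH. Qed.

Lemma cabs_real (x : R) : cabs (x%:C)%C = `|x|.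
Proof. by apply: cabs_inj_real; rewrite normc_def /= expr0n addr0 sqrtr_sqr. Qed.

Lemma cabs_nat n : cabs n%:R = n%:R.
Proof. by apply: cabs_inj_real; rewrite normr_nat rmorph_nat. Qed.

Lemma cabs_leD z w : cabs (z + w) <= cabs z + cabs w.
Proof. by rewrite cabs_leC rmorphD /= -!cabsE ler_normD. Qed.

Lemma cabs_leB z w : cabs (z - w) <= cabs z + cabs w.
Proof. by rewrite (le_trans (cabs_leD _ _))// cabsN. Qed.

Lemma cabs_le_sum (I : Type) (r : seq I) (P : pred I) (F : I -> R[i]%C) :
  cabs (\sum_(i <- r | P i) F i) <= \sum_(i <- r | P i) cabs (F i).
Proof.
elim/big_rec2: _ => [|i x z _ le_zx]; first by rewrite cabs0.
by rewrite (le_trans (cabs_leD _ _))// lerD2l.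
Qed.

Lemma cabs_prod (I : Type) (r : seq I) (P : pred I) (F : I -> R[i]%C) :
  cabs (\prod_(i <- r | P i) F i) = \prod_(i <- r | P i) cabs (F i).
Proof. by elim/big_rec2: _ => [|i x z _ <-]; rewrite ?cabs1// cabsM. Qed.

Lemma cabs_conj z : cabs (z^*) = cabs z.
Proof. by rewrite /cabs norm_conjC. Qed.

Lemma cabs_eq0 z : (cabs z == 0) = (z == 0).
Proof. by rewrite -[RHS]normr_eq0 cabsE fmorph_eq0. Qed.
End ComplexModulus.

Lemma size_prod_exp_linear (F : fieldType) (I : finType) (L : I -> {poly F})
    (e : I -> nat) :
  (forall i, size (L i) <= 2)%N ->
  (size (\prod_i L i ^+ e i)%R <= (\sum_i e i).+1)%N.
Proof.
move=> szL; elim/big_rec2: _ => [|i n P _ szP]; first by rewrite size_poly1.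
apply: (leq_trans (size_polyMleq _ _)).
have := size_poly_exp_leq (L i) (e i).
have : ((size (L i)).-1 * e i <= e i)%N.
  by have := szL i; case: (size _) => [|[|[]]]//= _; rewrite mul1n.
move: ((size (L i)).-1 * e i)%N (size (L i ^+ e i)) (size P) szP => u v w; lia.
Qed.

(** * Character sums over extensions of even degree *)

Section EvenExtension.
Variables (R : realType) (p : nat) (pr_p : prime p).
Variable chi : 'F_p -> R[i]%C.
Hypotheses (chi_sum0 : \sum_x chi x = 0) (chi0 : chi 0 = 0).
Hypothesis chi_le1 : forall x, cabs (chi x) <= 1.
Variables (e : 'F_p -> nat) (a : 'F_p).
Hypothesis ea : e a = 1%N.
Variables (j : nat) (E : finFieldType) (em : {rmorphism 'F_p -> E}).
Hypothesis cardEj : #|E| = (p ^ (2 * j))%N.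
Let g := (\sum_b e b)%N.
Hypothesis j_large : (4 + 2 * g < p ^ j)%N.

Let F : {poly E} := \prod_b ((em b)%:P - 'X) ^+ e b.
Let m := (\sum_(0 <= t < 2 * j) p ^ t)%N.
Let arg x : 'F_p := \prod_b (charpolyF (2 * j) em x).[b] ^+ e b.
Let N (c : 'F_p) := #|[set x : E | arg x == c]%SET|.

Let em_arg x : em (arg x) = F.[x] ^+ m.
Proof.
rewrite /arg rmorph_prod /F horner_prod -prodrXl; apply: eq_bigr => b _.
rewrite rmorphXn charpolyF_eval// horner_exp hornerD hornerN hornerC hornerX.
by rewrite exprAC.
Qed.

Let m_div : m = (((p ^ j) ^ 2 - 1) %/ p.-1)%N.
Proof.
have p1 : (0 < p.-1)%N by rewrite -ltnS prednK ?prime_gt0// prime_gt1.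
rewrite -expnM (mulnC j) subn1 predn_exp mulKn//.
by rewrite /m big_mkord.
Qed.

Let sizeF : (size F <= g.+1)%N.
Proof.
apply: size_prod_exp_linear => b.
by rewrite -[_ - 'X]opprB size_polyN size_XsubC.
Qed.

(** Stepanov's bound with [n = p - 1]: by [m_div], the norm exponent [m] is
    [(#|E| - 1) / (p - 1)]. *)
Let N_bound c : (p.-1 * N c <= (p ^ j) ^ 2 + p.-1 * (2 * g + 2) * p ^ j)%N.
Proof.
have charE := card_finPcharP cardEj pr_p.
have p1 : (0 < p.-1)%N by rewrite -ltnS prednK ?prime_gt0// prime_gt1.
pose U : {poly E} := - \prod_(b | b != a) ((em b)%:P - 'X) ^+ e b.
have FE : F = ('X - (em a)%:P) * U.
  by rewrite /F (bigD1 a)//= ea expr1 /U mulrN -mulNr opprB.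
have Ua : U.[em a] != 0.
  rewrite hornerN oppr_eq0 horner_prod prodf_seq_neq0; apply/allP => b _.
  apply/implyP => ba; rewrite horner_exp expf_neq0// hornerD hornerN hornerC hornerX.
  by rewrite subr_eq0 (inj_eq (fmorph_inj em)).
have Rns : (p ^ j = (p.-1 * (\sum_(i < j) p ^ i)).+1)%N.
  by rewrite -predn_exp prednK// expn_gt0 prime_gt0.
have cE2 : #|E| = ((p ^ j) ^ 2)%N by rewrite cardEj mulnC expnM.
have := stepanov_bound charE cE2 p1 Rns (em c) FE Ua sizeF j_large.
rewrite -m_div; congr (p.-1 * _ <= _)%N; apply: eq_card => x.
by rewrite !inE -em_arg (inj_eq (fmorph_inj em)).
Qed.

Let N_sum : (\sum_c N c = (p ^ j) ^ 2)%N.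
Proof.
rewrite -expnM (mulnC j) -cardEj -sum1_card (partition_big arg xpredT)//=.
apply: eq_bigr => c _; rewrite /N -sum1_card; apply: eq_bigl => x.
by rewrite inE.
Qed.

Let N0_le : (N 0%R <= g)%N.
Proof.
have F0 : F != 0.
  rewrite prodf_seq_neq0; apply/allP => b _; rewrite expf_neq0//=.
  by rewrite -size_poly_gt0 -[_ - 'X]opprB size_polyN size_XsubC.
rewrite /N; set A := [set x | _]%SET.
have rA : all (root F) (enum A).
  apply/allP => x; rewrite mem_enum inE => /eqP ax; have := em_arg x.
  by rewrite ax rmorph0 => /esym/eqP; rewrite expf_eq0 => /andP[].
have := max_poly_roots F0 rA (enum_uniq _); rewrite -cardE => h.
by rewrite -ltnS (leq_trans h).
Qed.

(** Stepanov's method gives only an upper bound [T] on the fibres [N c]. As [chi] sums to 0, [N c]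
    may be replaced by [N c - T]; the absolute values are then [T - N c], whose sum follows from the
    total count, so the one-sided bound suffices. *)
Lemma even_ext_sum_bound :
  cabs (\sum_x poly_char chi e (charpolyF (2 * j) em x))
  <= (p.-1 * (2 * g + 2) + g)%:R * p%:R ^+ j.
Proof.
have p1 : (0 < p.-1)%N by rewrite -ltnS prednK ?prime_gt0// prime_gt1.
have p10 : p.-1%:R != 0 :> R by rewrite pnatr_eq0 -lt0n.
pose Bd : nat := ((p ^ j) ^ 2 + p.-1 * (2 * g + 2) * p ^ j)%N.
pose T : R := Bd%:R / p.-1%:R.
have NT c : (N c)%:R <= T.
  rewrite ler_pdivlMr ?ltr0n// -natrM ler_nat mulnC; exact: N_bound.
have -> : \sum_x poly_char chi e (charpolyF (2 * j) em x) =
    \sum_c chi c * (((N c)%:R - T)%:C)%C.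
  transitivity (\sum_c chi c * (N c)%:R).
    rewrite (partition_big arg xpredT)//=; apply: eq_bigr => c _.
    rewrite (eq_bigr (fun => chi c)); last by move=> x /eqP <-.
    rewrite sumr_const -[LHS]mulr_natr; congr (_ * _%:R); apply: eq_card => x.
    by rewrite !inE.
  under [RHS]eq_bigr do rewrite rmorphB /= mulrBr rmorph_nat.
  by rewrite sumrB -mulr_suml chi_sum0 mul0r subr0.
apply: (le_trans (cabs_le_sum _ _ _)).
have -> : (p.-1 * (2 * g + 2) + g)%:R * p%:R ^+ j =
    (p.-1 * (2 * g + 2))%:R * p%:R ^+ j + g%:R * p%:R ^+ j :> R.
  by rewrite natrD mulrDl.
rewrite (bigD1 0)//= chi0 mul0r cabs0 add0r.
apply: (@le_trans _ _ (\sum_(c : 'F_p | c != 0) (T - (N c)%:R))).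
  apply: ler_sum => c _; rewrite cabsM cabs_real distrC ger0_norm ?subr_ge0//.
  by rewrite ler_piMl// subr_ge0.
rewrite sumrB sumr_const.
have -> : #|[pred c : 'F_p | c != 0]| = p.-1.
  by rewrite (cardC1 (0 : 'F_p)) card_Fp.
rewrite -(mulr_natr T) /T divfK//.
have NS : \sum_(c : 'F_p | c != 0) (N c)%:R = ((p ^ j) ^ 2)%:R - (N 0)%:R :> R.
  by rewrite -N_sum [in RHS](bigD1 0)//= natrD natr_sum addrAC subrr add0r.
rewrite [X in _ - X]NS.
have -> : Bd%:R - (((p ^ j) ^ 2)%:R - (N 0)%:R) =
    (p.-1 * (2 * g + 2))%:R * p%:R ^+ j + (N 0)%:R :> R.
  rewrite -natrX -natrM /Bd natrD; move: ((p ^ j) ^ 2)%N => Q.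
  by move: (p.-1 * (2 * g + 2) * p ^ j)%N => W; ring.
rewrite lerD2l.
rewrite (@le_trans _ _ g%:R) ?ler_nat// ler_peMr// ?ler0n// exprn_ege1// ler1n.
exact: prime_gt0.
Qed.
End EvenExtension.

Lemma bounded_powers_le1 (R : realType) (x B : R) (J : nat) :
  0 <= x -> (forall j, (J <= j)%N -> x ^+ j <= B) -> x <= 1.
Proof.
move=> x0 xB; rewrite leNgt; apply/negP => x1.
have bern j : 1 + (x - 1) *+ j <= x ^+ j.
  elim: j => [|j IH]; first by rewrite mulr0n addr0.
  rewrite exprS mulrSr addrA.
  have h : 1 <= x ^+ j by rewrite exprn_ege1// ltW.
  rewrite -[X in _ <= X](subrK (x ^+ j)) addrC; apply: lerD => //.
  by rewrite -[X in _ <= _ - X]mul1r -mulrBl ler_peMr// subr_ge0 ltW.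
have d0 : 0 < x - 1 by rewrite subr_gt0.
pose n := Num.bound (`|B| / (x - 1)).
have Bn : `|B| < (x - 1) * n%:R.
  by rewrite mulrC -ltr_pdivrMr// archi_boundP// divr_ge0// ltW.
have := xB (maxn J n) (leq_maxl _ _); apply/negP; rewrite -ltNge.
apply: lt_le_trans (bern _); rewrite -mulr_natr.
apply: (le_lt_trans (ler_norm B)); apply: (lt_le_trans Bn).
by rewrite -[X in X <= _]add0r lerD// ler_pM2l// ler_nat leq_maxr.
Qed.

Lemma Fp_extension_family (p : nat) : prime p ->
  exists (E : nat -> finFieldType) (em : forall k, {rmorphism 'F_p -> E k}),
    forall k, (0 < k)%N -> #|E k| = (p ^ k)%N.
Proof.
move=> pr_p.
have fam k : {Ek : finFieldType & {rmorphism 'F_p -> Ek} & #|Ek| = (p ^ k.+1)%N}.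
  have [Fm chF cF] := pPrimePowerField pr_p (ltn0Sn k).
  pose Ek : finFieldType := pPrimeCharType chF.
  by exists Ek; first exact: (in_alg (pPrimeCharType chF)).
(* The shift matches the degree for [k > 0]; [E 0] is a dummy equal to [E 1]. *)
exists (fun k => projT1 (sigT_of_sigT2 (fam k.-1))).
exists (fun k => projT2 (sigT_of_sigT2 (fam k.-1))).
move=> [//|k] _ /=; by case: (fam k).
Qed.

(** * From even power sums to Weil's bound *)

Section WeilBound.
Variables (R : realType) (p : nat) (pr_p : prime p).
Variable chi : 'F_p -> R[i]%C.
Hypotheses (chiM : forall x y, chi (x * y) = chi x * chi y) (chi1 : chi 1 = 1).
Hypotheses (chi_sum0 : \sum_x chi x = 0) (chi0 : chi 0 = 0).
Hypothesis chi_le1 : forall x, cabs (chi x) <= 1.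
Variables (e : 'F_p -> nat) (a : 'F_p).
Hypothesis ea : e a = 1%N.

Theorem weil_bound :
  cabs (\sum_x chi (\prod_b (b - x) ^+ e b))
  <= #|[set b | (0 < e b)%N]%SET|%:R * Num.sqrt p%:R.
Proof.
set s := #|_|.
have [E [em cardEk]] := Fp_extension_family pr_p.
pose Lam := poly_char chi e.
have LamM := poly_charM chiM e.
pose S k := ext_sum em Lam k.
pose c m := monic_sum Lam m.
have c0 : c 0%N = 1.
  rewrite /c /monic_sum.
  have u0 (u : {poly_0 'F_p}) : u = 0.
    by apply/npolyP => i; rewrite coef0 nth_default// (leq_trans (size_npoly u)).
  rewrite (bigD1 0)//= big1 ?addr0; last by move=> u /eqP; rewrite (u0 u).
  rewrite /Lam /poly_char big1 ?chi1// => b _.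
  by rewrite expr0 hornerC expr1n.
have cs m : (s < m)%N -> c m = 0.
  by move=> sm; apply: (monic_sum_eq0 pr_p chiM chi_sum0 ea); exact: ltnW.
have cS m : m%:R * c m = \sum_(1 <= k < m.+1) S k * c (m - k)%N.
  exact: newton_identity.
have [al szal SE] := newton_solution c0 cs cS.
pose g := (\sum_b e b)%N.
pose B := (p.-1 * (2 * g + 2) + g)%N.
have p_gt0 : 0 < p%:R :> R by rewrite ltr0n prime_gt0.
have p_neq0 : p%:R != 0 :> R by rewrite gt_eqF.
have S2 k : (5 + 2 * g <= k)%N -> cabs (S (2 * k)%N) <= B%:R * p%:R ^+ k.
  move=> gk; apply: (even_ext_sum_bound pr_p chi_sum0 chi0 chi_le1 ea).
    by rewrite cardEk// muln_gt0 (leq_trans _ gk).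
  by rewrite (leq_trans _ (ltnW (ltn_expl k (prime_gt1 pr_p)))).
(* Only even power sums are bounded. They are the power sums of the squares, so interpolation shows
   that [(z ^+ 2) ^+ k] is [O(p ^ k)] for each inverse root [z], and letting [k] grow gives
   [cabs z ^+ 2 <= p]. *)
pose be := [seq z ^+ 2 | z <- al].
have beE k : \sum_(b <- be) b ^+ k = \sum_(z <- al) z ^+ (2 * k).
  by rewrite big_map; apply: eq_bigr => z _; rewrite exprM.
have al_le z : z \in al -> cabs z <= Num.sqrt p%:R.
  move=> zin; have bin : z ^+ 2 \in be by apply/mapP; exists z.
  have [P [u [u0 uE]]] := power_sum_interpolation bin.
  have u_gt0 : 0 < cabs u by rewrite lt_neqAle cabs_ge0 eq_sym cabs_eq0 u0.
  pose B2 := \sum_(t < size P) cabs P`_t * (B%:R * p%:R ^+ t).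
  have : cabs (z ^+ 2) / p%:R <= 1.
    apply: (@bounded_powers_le1 _ _ (B2 / cabs u) (5 + 2 * g)).
      by rewrite divr_ge0 ?cabs_ge0// ltW.
    move=> k gk; rewrite ler_pdivlMr// expr_div_n mulrAC ler_pdivrMr ?exprn_gt0//.
    rewrite mulrC -cabsX -cabsM uE /B2 mulr_suml.
    apply: (le_trans (cabs_le_sum _ _ _)); apply: ler_sum => t _.
    rewrite cabsM -!mulrA ler_wpM2l ?cabs_ge0// beE -exprD addnC.
    rewrite -[X in cabs X]opprK -SE ?cabsN ?S2//.
      by rewrite (leq_trans gk)// leq_addl.
    by rewrite muln_gt0 addn_gt0 (leq_trans _ gk) ?orbT.
  rewrite ler_pdivrMr// mul1r cabsX => z2.
  by rewrite -(ler_pXn2r (ltn0Sn 1)) ?nnegrE ?cabs_ge0 ?sqrtr_ge0// sqr_sqrtr// ltW.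
(* [E 1] is a copy of ['F_p], where the characteristic polynomial of [x] is [X - x]. *)
have -> : \sum_x chi (\prod_b (b - x) ^+ e b) = S 1%N.
  have cE1 := cardEk 1%N isT.
  have emb : bijective (em 1%N).
    apply: inj_card_bij; first exact: fmorph_inj.
    by rewrite cE1 expn1 card_Fp.
  rewrite /S /ext_sum (reindex (em 1%N)) /=; last exact: onW_bij.
  apply: eq_bigr => x _; rewrite /Lam /poly_char; congr chi.
  apply: eq_bigr => b _; congr (_ ^+ _); apply: (fmorph_inj (em 1%N)).
  by rewrite charpolyF_eval// big_nat1 expn0 expr1 rmorphB.
rewrite SE// cabsN.
apply: (@le_trans _ _ (\sum_(z <- al) Num.sqrt p%:R)).
  apply: (le_trans (cabs_le_sum _ _ _)).
  rewrite big_seq [X in _ <= X]big_seq; apply: ler_sum => z zin.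
  by rewrite expr1 al_le.
rewrite big_const_seq iter_addr_0 -[X in X <= _]mulr_natl count_predT.
by rewrite ler_wpM2r ?sqrtr_ge0// ler_nat.
Qed.
End WeilBound.

(** * Moments of short character sums *)

Lemma prod_exp_count (F : comNzRingType) (I J : finType) (b : I -> J) (G : J -> F) :
  \prod_v G v ^+ (\sum_i (b i == v))%N = \prod_i G (b i).
Proof.
under eq_bigr do rewrite expr_sum.
rewrite exchange_big /=; apply: eq_bigr => i _.
rewrite (bigD1 (b i))//= eqxx expr1 big1 ?mulr1// => v.
by rewrite eq_sym => /negPf ->.
Qed.

(** If no value occurs exactly once among the [2 r] entries, at most [r] values occur: [vv] lists
    them, and two index maps recover [f] and [g]. *)
Lemma card_pairs_no_simple_value (r M : nat) : (0 < r)%N ->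
  (#|[set fg : {ffun 'I_r -> 'I_M} * {ffun 'I_r -> 'I_M} |
      [forall v, \sum_i (fg.1 i == v) + \sum_i (fg.2 i == v) != 1]]%SET|
    <= r ^ (2 * r) * M ^ r)%N.
Proof.
move=> r_gt0; set A := [set _ | _]%SET.
pose X : finType := ({ffun 'I_r -> 'I_r} * {ffun 'I_r -> 'I_r} * {ffun 'I_r -> 'I_M})%type.
pose h (x : X) : {ffun 'I_r -> 'I_M} * {ffun 'I_r -> 'I_M} :=
  ([ffun i => x.2 (x.1.1 i)], [ffun i => x.2 (x.1.2 i)]).
have AX : A \subset h @: [set: X].
  apply/fintype.subsetP => -[f g]; rewrite inE /= => /forallP nosimple.
  pose S : {set 'I_M} := (f @: [set: 'I_r] :|: g @: [set: 'I_r])%SET.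
  have cntE (u : {ffun 'I_r -> 'I_M}) : (\sum_v \sum_i (u i == v) = r)%N.
    rewrite exchange_big /=; under eq_bigr => i _.
      rewrite (bigD1 (u i))//= eqxx big1 ?addn0; last by move=> v; rewrite eq_sym => /negPf ->.
      over.
    by rewrite sum1_card card_ord.
  have cntS (v : 'I_M) : v \in S -> (2 <= \sum_i (f i == v) + \sum_i (g i == v))%N.
    move=> vS; have := nosimple v.
    suff : (0 < \sum_i (f i == v) + \sum_i (g i == v))%N by case: (_ + _)%N => [|[]].
    have pos (u : {ffun 'I_r -> 'I_M}) i : (0 < \sum_k (u k == u i))%N.
      by rewrite (bigD1 i)//= eqxx.
    by case/setUP: vS => /imsetP[i _ ->]; rewrite addn_gt0 pos ?orbT.
  have cardS : (#|S| <= r)%N.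
    have : (#|S| * 2 <= \sum_v (\sum_i (f i == v) + \sum_i (g i == v)))%N.
      rewrite -sum1_card big_distrl /= [X in (_ <= X)%N](bigID (mem S)) /=.
      by apply: leq_trans (leq_addr _ _); apply: leq_sum => v vS; rewrite mul1n cntS.
    by rewrite big_split /= !cntE addnn -muln2 leq_pmul2r.
  have fS i : f i \in S by apply/setUP; left; apply: imset_f.
  have gS i : g i \in S by apply/setUP; right; apply: imset_f.
  have szS : size (enum S) = #|S| by rewrite cardE.
  pose v0 := f (Ordinal r_gt0).
  pose vv : {ffun 'I_r -> 'I_M} := [ffun i : 'I_r => nth v0 (enum S) i].
  have idx m : m \in S -> (index m (enum S) < r)%N.
    by move=> mS; rewrite (leq_trans _ cardS)// -szS index_mem mem_enum.
  pose s1 : {ffun 'I_r -> 'I_r} := [ffun i => Ordinal (idx _ (fS i))].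
  pose s2 : {ffun 'I_r -> 'I_r} := [ffun i => Ordinal (idx _ (gS i))].
  apply/imsetP; exists (s1, s2, vv); first by rewrite inE.
  apply: injective_projections => /=;
    by apply/ffunP => i; rewrite !ffunE /= nth_index ?mem_enum.
apply: (leq_trans (subset_leq_card AX)); apply: (leq_trans (leq_imset_card _ _)).
rewrite cardsT !card_prod !card_ffun !card_ord.
by rewrite mul2n -addnn expnD.
Qed.

Section Moments.
Variables (R : realType) (p : nat) (pr_p : prime p).
Variable chi : 'F_p -> R[i]%C.
Hypotheses (chiM : forall x y, chi (x * y) = chi x * chi y) (chi1 : chi 1 = 1).
Hypotheses (chi_sum0 : \sum_x chi x = 0) (chi0 : chi 0 = 0).

Lemma chiX x n : chi (x ^+ n) = chi x ^+ n.
Proof. by elim: n => [|n IH]; rewrite ?expr0// !exprS chiM IH. Qed.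

Lemma chi_prod (I : Type) (r : seq I) (F : I -> 'F_p) :
  chi (\prod_(i <- r) F i) = \prod_(i <- r) chi (F i).
Proof. by elim/big_rec2: _ => // i x y _ <-. Qed.

Lemma chi_exp_unit x : x != 0 -> chi x ^+ p.-1 = 1.
Proof.
move=> x0; rewrite -chiX; have := expf_card x; rewrite card_Fp// => xp.
have -> : x ^+ p.-1 = 1.
  by apply: (mulfI x0); rewrite -exprS prednK ?prime_gt0// mulr1.
exact: chi1.
Qed.

Lemma cabs_chi x : x != 0 -> cabs (chi x) = 1.
Proof.
move=> x0; apply/eqP; rewrite -(@pexpr_eq1 _ _ p.-1) ?cabs_ge0//.
  by rewrite -cabsX chi_exp_unit// cabs1.
by rewrite -ltnS prednK ?prime_gt0// prime_gt1.
Qed.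

Lemma cabs_chi_le1 x : cabs (chi x) <= 1.
Proof. by have [->|/cabs_chi ->//] := eqVneq x 0; rewrite chi0 cabs0. Qed.

(* The exponent is [-1] modulo [p - 1], shifted so as to be positive even for [p = 2]. *)
Lemma conj_chi x : (chi x)^* = chi (x ^+ (2 * p - 3)).
Proof.
have p2 : (1 < p)%N := prime_gt1 pr_p.
have [->|x0] := eqVneq x 0.
  by rewrite expr0n subn_eq0 leqNgt (_ : 3 < 2 * p)%N ?chi0 ?rmorph0//; lia.
have cx0 : chi x != 0 by rewrite -cabs_eq0 cabs_chi// oner_eq0.
apply: (mulfI cx0); rewrite -normCK cabsE cabs_chi// -chiM -exprS.
have -> : ((2 * p - 3).+1 = p.-1 * 2)%N by lia.
by rewrite chiX exprM chi_exp_unit// !expr1n.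
Qed.

Section Correlation.
Variables (r M : nat) (b : 'I_M -> 'F_p).
Hypothesis b_inj : injective b.
Implicit Types f g : {ffun 'I_r -> 'I_M}.

Definition correlation f g : R[i]%C :=
  \sum_x (\prod_i chi (x + b (f i))) * (\prod_i (chi (x + b (g i)))^*).

Lemma correlation_le_p f g : cabs (correlation f g) <= p%:R.
Proof.
apply: (le_trans (cabs_le_sum _ _ _)).
apply: (@le_trans _ _ (\sum_(x : 'F_p) 1)); last by rewrite sumr_const card_Fp.
apply: ler_sum => x _; rewrite cabsM !cabs_prod.
have h (u : {ffun 'I_r -> 'I_M}) : 0 <= \prod_i cabs (chi (x + b (u i))) <= 1.
  rewrite prodr_ge0 /=; last by move=> i _; exact: cabs_ge0.
  by apply: prodr_ile1 => i _; rewrite cabs_ge0 cabs_chi_le1.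
under [X in _ * X]eq_bigr do rewrite cabs_conj.
by have /andP[f0 f1] := h f; have /andP[g0 g1] := h g; rewrite mulr_ile1.
Qed.

(** By [conj_chi] and the substitution of [- x] for [x], the correlation is a complete sum of [chi]
    over a product of powers of [y - x]. The point [b v] has exponent 1 and at most [2 r] points
    occur, so Weil's bound applies. *)
Lemma correlation_simple f g v :
  (\sum_i (f i == v) = 1)%N -> (\sum_i (g i == v) = 0)%N ->
  cabs (correlation f g) <= (2 * r)%:R * Num.sqrt p%:R.
Proof.
move=> fv gv.
pose E0 := (2 * p - 3)%N.
pose e (y : 'F_p) := (\sum_i (b (f i) == y) + E0 * \sum_i (b (g i) == y))%N.
have ev : e (b v) = 1%N.
  rewrite /e; under eq_bigr do rewrite (inj_eq b_inj).
  under [X in (_ * X)%N]eq_bigr do rewrite (inj_eq b_inj).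
  by rewrite fv gv muln0.
have -> : correlation f g = \sum_x chi (\prod_y (y - x) ^+ e y).
  rewrite /correlation (reindex_inj oppr_inj); apply: eq_bigr => x _ /=.
  under [X in _ * X]eq_bigr do rewrite conj_chi chiX.
  rewrite prodrXl -!chi_prod -chiX -chiM; congr chi.
  under [RHS]eq_bigr do rewrite /e exprD [(E0 * _)%N]mulnC exprM.
  rewrite big_split /= prodrXl !(prod_exp_count _ (fun y => y - x)).
  by congr (_ * _ ^+ _); apply: eq_bigr => i _; rewrite addrC.
apply: (le_trans (weil_bound pr_p chiM chi1 chi_sum0 chi0 cabs_chi_le1 ev)).
rewrite ler_wpM2r ?sqrtr_ge0// ler_nat.
pose im (u : {ffun 'I_r -> 'I_M}) : {set 'F_p} := ((fun i => b (u i)) @: [set: 'I_r])%SET.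
have imle u : (#|im u| <= r)%N.
  by apply: (leq_trans (leq_imset_card _ _)); rewrite cardsT card_ord.
apply: (@leq_trans #|(im f :|: im g)%SET|); last first.
  by apply: (leq_trans (leq_card_setU _ _)); rewrite mul2n -addnn leq_add.
apply/subset_leq_card/fintype.subsetP => y; rewrite inE => ey; apply/setUP.
have notim u : y \notin im u -> (\sum_i (b (u i) == y) = 0)%N.
  move=> yu; apply: big1 => i _; apply/eqP; rewrite eqb0; apply: contraNN yu => /eqP <-.
  exact: imset_f.
apply/orP; apply: contraLR ey; rewrite negb_or => /andP[/notim yf /notim yg].
by rewrite /e yf yg muln0.
Qed.

(** Moves a simple value from [g] to [f], where no conjugation raises its exponent. *)
Lemma correlation_conj f g : cabs (correlation g f) = cabs (correlation f g).
Proof.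
rewrite -[LHS]cabs_conj /correlation rmorph_sum; congr cabs; apply: eq_bigr => x _ /=.
rewrite rmorphM !rmorph_prod mulrC /=; congr (_ * _).
by apply: eq_bigr => i _; rewrite conjCK.
Qed.

(** The expansion has one correlation per pair [(f, g)]: the few pairs without a simple value get
    the trivial bound [p], the others Weil's bound. *)
Lemma moment_bound (a : 'I_M -> R[i]%C) : (0 < r)%N ->
  (forall t, cabs (a t) <= 1) ->
  \sum_x cabs (\sum_t a t * chi (x + b t)) ^+ (2 * r) <=
  (r ^ (2 * r))%:R * (p%:R * M%:R ^+ r)
  + (2 * r)%:R * (Num.sqrt p%:R * M%:R ^+ (2 * r)).
Proof.
move=> r_gt0 a1.
pose T : finType := {ffun 'I_r -> 'I_M}.
have -> : \sum_x cabs (\sum_t a t * chi (x + b t)) ^+ (2 * r) =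
    cabs (\sum_(f : T) \sum_(g : T)
      (\prod_i a (f i)) * (\prod_i (a (g i))^*) * correlation f g).
  rewrite -[LHS]ger0_norm; last by apply: sumr_ge0 => x _; rewrite exprn_ge0 ?cabs_ge0.
  rewrite -cabs_real rmorph_sum /=; congr cabs.
  transitivity (\sum_x \sum_(f : T) \sum_(g : T)
     (\prod_i (a (f i) * chi (x + b (f i)))) * (\prod_i (a (g i) * chi (x + b (g i)))^*)).
    apply: eq_bigr => x _; rewrite exprM rmorphXn rmorphXn /= -cabsE normCK exprMn.
    rewrite rmorph_sum /=.
    have powE (G : 'I_M -> R[i]%C) : (\sum_t G t) ^+ r = \sum_(f : T) \prod_i G (f i).
      by rewrite -(bigA_distr_bigA (fun=> G)) prodr_const card_ord.
    by rewrite !powE mulr_suml; apply: eq_bigr => f _; rewrite mulr_sumr.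
  rewrite exchange_big /=; apply: eq_bigr => f _.
  rewrite exchange_big /=; apply: eq_bigr => g _.
  rewrite /correlation mulr_sumr; apply: eq_bigr => x _.
  under [X in _ * X = _]eq_bigr do rewrite rmorphM /=.
  by rewrite !big_split /= mulrACA.
apply: (@le_trans _ _ (\sum_(f : T) \sum_(g : T) cabs (correlation f g))).
  apply: (le_trans (cabs_le_sum _ _ _)); apply: ler_sum => f _.
  apply: (le_trans (cabs_le_sum _ _ _)); apply: ler_sum => g _.
  rewrite !cabsM ler_piMl ?cabs_ge0// !cabs_prod.
  under [X in _ * X]eq_bigr do rewrite cabs_conj.
  have h (u : T) : 0 <= \prod_i cabs (a (u i)) <= 1.
    rewrite prodr_ge0 /=; last by move=> i _; exact: cabs_ge0.
    by apply: prodr_ile1 => i _; rewrite cabs_ge0 a1.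
  by have /andP[f0 f1] := h f; have /andP[g0 g1] := h g; rewrite mulr_ile1.
rewrite pair_bigA /=.
pose bad (fg : T * T) := [forall v, \sum_i (fg.1 i == v) + \sum_i (fg.2 i == v) != 1]%N.
rewrite (bigID bad) /=; apply: lerD.
  apply: (@le_trans _ _ (\sum_(fg : T * T | bad fg) p%:R)).
    by apply: ler_sum => fg _; exact: correlation_le_p.
  rewrite sumr_const -[X in X <= _]mulr_natl mulrCA mulrC ler_wpM2l ?ler0n//.
  rewrite -natrX -natrM ler_nat.
  apply: leq_trans (card_pairs_no_simple_value M r_gt0).
  by apply/eq_leq/eq_card => fg; rewrite !inE.
apply: (@le_trans _ _ (\sum_(fg : T * T | ~~ bad fg) (2 * r)%:R * Num.sqrt p%:R)).
  apply: ler_sum => -[f g] /=; rewrite /bad negb_forall => /existsP[v] /=.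
  rewrite negbK => /eqP sv.
  have [fv|fv] := eqVneq (\sum_i (f i == v))%N 1%N.
    by apply: (correlation_simple fv); move: sv; rewrite fv => -[].
  have gv : (\sum_i (g i == v))%N = 1%N.
    by move: sv fv; case: (\sum_i (f i == v))%N => [//|[]].
  rewrite -correlation_conj; apply: (correlation_simple gv).
  by move: sv; rewrite gv addn1 => -[].
rewrite sumr_const -[X in X <= _]mulr_natr -mulrA ler_wpM2l ?ler0n//.
rewrite ler_wpM2l ?sqrtr_ge0// -natrX ler_nat.
apply: (leq_trans (max_card _)); rewrite card_prod !card_ffun !card_ord.
by rewrite mul2n -addnn expnD.
Qed.
End Correlation.
End Moments.

(** * Maximal functions of short sums *)

Section Dyadic.
Variables (R : realType) (b : nat -> R[i]%C).

Definition dyadic_block l j : R[i]%C := \sum_(t < 2 ^ l) b (j * 2 ^ l + t)%N.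

(** By the binary expansion of [M], a prefix uses at most one block per level. The position [q] is
    general because the induction descends into either half. *)
Lemma prefix_le_dyadic_blocks (B : R) (L q M : nat) : 0 <= B ->
  (forall l j, (l < L)%N -> (q * 2 ^ (L - l) <= j < q.+1 * 2 ^ (L - l))%N ->
    cabs (dyadic_block l j) <= B) ->
  (M < 2 ^ L)%N ->
  cabs (\sum_(t < M) b (q * 2 ^ L + t)%N) <= L%:R * B.
Proof.
move=> B0; elim: L q M => [|L IH] q M Hb ltM.
  by move: ltM; rewrite expn0 ltnS leqn0 => /eqP ->; rewrite big_ord0 cabs0 mul0r.
have Hq c : (c <= 1)%N -> forall l j, (l < L)%N ->
   ((2 * q + c) * 2 ^ (L - l) <= j < (2 * q + c).+1 * 2 ^ (L - l))%N ->
   cabs (dyadic_block l j) <= B.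
  move=> c1 l j lL jr; apply: Hb; first exact: ltnW.
  rewrite (subSn (ltnW lL)) expnS; move: (2 ^ (L - l))%N jr => u /andP[j1 j2].
  by apply/andP; split; case: c c1 j1 j2 => [|[]]// _; nia.
rewrite -natr1 mulrDl mul1r.
have q2 : (q * 2 ^ L.+1 = 2 * q * 2 ^ L)%N by rewrite expnS mulnCA mulnA.
have [ltM2|leM2] := ltnP M (2 ^ L).
  apply: ler_wpDr => //; rewrite q2 -[(2 * q)%N]addn0; apply: IH => //.
  exact: Hq.
rewrite -(subnKC leM2) big_split_ord /= (le_trans (cabs_leD _ _))// addrC.
apply: lerD.
  rewrite [X in cabs X](eq_bigr (fun t : 'I_(M - 2 ^ L) => b ((2 * q + 1) * 2 ^ L + t)%N)).
    apply: IH; first exact: Hq.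
    by move: ltM; rewrite expnS; move: (2 ^ L)%N leM2 => u; lia.
  by move=> t _; rewrite q2 addnA mulnDl mul1n.
have -> : \sum_(i < 2 ^ L) b (q * 2 ^ L.+1 + i)%N = dyadic_block L (2 * q)%N.
  by apply: eq_bigr => t _; rewrite q2.
by apply: Hb => //; rewrite subSn// subnn expn1; lia.
Qed.
End Dyadic.

Lemma root_power (R : realType) (x : R) (n : nat) : (0 < n)%N -> 0 <= x ->
  exists2 y, 0 <= y & y ^+ n = x.
Proof.
move=> n_gt0 x0; exists (x `^ (n%:R^-1)); first exact: powR_ge0.
by rewrite -powR_mulrn ?powR_ge0// -powRrM mulVf ?pnatr_eq0 -?lt0n// powRr1.
Qed.

Lemma abel_bound (R : realType) (w u : nat -> R[i]%C) (B eps : R) (M : nat) :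
  0 <= B ->
  (forall n, (n <= M)%N -> cabs (\sum_(t < n) u t) <= B) ->
  (forall t, cabs (w t) <= 1) ->
  (forall t, (t.+1 <= M)%N -> cabs (w t.+1 - w t) <= eps) ->
  cabs (\sum_(t < M) w t * u t) <= (1 + M%:R * eps) * B.
Proof.
move=> B0 HB w1 weps; case: M HB weps => [|M] HB weps.
  by rewrite big_ord0 cabs0 mul0r addr0 mul1r.
have -> : \sum_(t < M.+1) w t * u t = w M * (\sum_(t < M.+1) u t)
    - \sum_(t < M) (w t.+1 - w t) * \sum_(i < t.+1) u i.
  elim: M {HB weps} => [|M IH]; first by rewrite big_ord0 !big_ord_recr !big_ord0 /= !add0r subr0.
  rewrite [LHS]big_ord_recr /= IH.
  rewrite [X in _ = _ * X - _]big_ord_recr [X in _ = _ - X]big_ord_recr /=.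
  by ring.
apply: (le_trans (cabs_leB _ _)); rewrite mulrDl mul1r; apply: lerD.
  by rewrite cabsM -[B]mul1r ler_pM ?cabs_ge0// HB.
have eps0 : 0 <= eps by apply: le_trans (weps 0%N isT); exact: cabs_ge0.
apply: (le_trans (cabs_le_sum _ _ _)).
apply: (@le_trans _ _ (\sum_(t < M) eps * B)).
  apply: ler_sum => t _; rewrite cabsM ler_pM ?cabs_ge0//.
    by rewrite weps// ltnW// ltnS.
  by rewrite HB// ltnS ltnW.
rewrite sumr_const card_ord -[X in X <= _]mulr_natl mulrA ler_wpM2r// ler_wpM2r// ler_nat.
exact: leqnSn.
Qed.

Section ExponentialPhase.
Variable R : realType.
Local Notation ee := (@expi2pi R).

Lemma expi2piD x y : ee (x + y) = ee x * ee y.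
Proof.
rewrite /expi2pi mulrDr cosD sinD; apply/eqP; rewrite eq_complex /=.
by apply/andP; split; apply/eqP => //; ring.
Qed.

Lemma expi2pi0 : ee 0 = 1.
Proof. by rewrite /expi2pi mulr0 cos0 sin0. Qed.

Lemma cabs_expi2pi x : cabs (ee x) = 1.
Proof.
by apply: cabs_inj_real; rewrite normc_def /= cos2Dsin2 sqrtr1.
Qed.

Lemma expi2pi_nat n : ee n%:R = 1.
Proof.
elim: n => [|n IH]; first exact: expi2pi0.
rewrite -natr1 expi2piD IH mul1r /expi2pi mulr1 (_ : 2 * pi = pi *+ 2); last by rewrite mulr_natl.
by rewrite cos2pi sin2pi.
Qed.

Lemma expi2pi_int (n : int) : ee n%:~R = 1.
Proof.
case: n => n; first exact: expi2pi_nat.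
have := expi2piD n.+1%:R (Negz n)%:~R; rewrite expi2pi_nat mul1r => <-.
by rewrite NegzE mulrNz addrN expi2pi0.
Qed.

Lemma norm_sin_le (x : R) : `|sin x| <= `|x|.
Proof.
wlog x0 : x / 0 < x => [hw|].
  have [xlt|xgt|->] := ltgtP x 0; last by rewrite sin0.
    by rewrite -normrN -sinN -[`|x|]normrN hw// oppr_gt0.
  exact: hw.
have cs : {within `[0, x], continuous (@sin R)}%classic.
  by apply: continuous_subspaceT => y; exact: continuous_sin.
have [c _ ] := @MVT_segment R sin cos 0 x (ltW x0) (fun y _ => is_derive_sin y) cs.
rewrite sin0 !subr0 => ->; rewrite normrM ler_piMl// ler_norml.
by rewrite cos_geN1 cos_le1.
Qed.

Lemma cabs_expi2piB x y : cabs (ee x - ee y) <= 2 * pi * `|x - y|.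
Proof.
have -> : ee x - ee y = ee y * (ee (x - y) - 1).
  by rewrite mulrBr mulr1 -expi2piD [y + _]addrC subrK.
rewrite cabsM cabs_expi2pi mul1r; move: (x - y) => u.
rewrite -(ler_pXn2r (ltn0Sn 1)) ?nnegrE ?cabs_ge0 ?mulr_ge0 ?pi_ge0//.
have -> : cabs (ee u - 1) ^+ 2 = (2 * `|sin (pi * u)|) ^+ 2.
  rewrite /cabs normc_def /= sqr_sqrtr ?addr_ge0 ?sqr_ge0//.
  rewrite exprMn real_normK ?num_real// subr0.
  have -> : 2 * pi * u = (pi * u) *+ 2 by rewrite -[RHS]mulr_natl mulrA.
  rewrite cos_mulr2n sin_mulr2n.
  have := cos2Dsin2 (pi * u); move: (cos _) (sin _) => C S CS.
  have CE : C ^+ 2 = 1 - S ^+ 2 by rewrite -CS addrK.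
  rewrite -[C * S *+ 2]mulr_natl !exprMn CE.
  by ring.
rewrite ler_pXn2r ?nnegrE ?mulr_ge0 ?pi_ge0// -mulrA ler_wpM2l//.
by rewrite (le_trans (norm_sin_le _))// normrM ger0_norm ?pi_ge0.
Qed.
End ExponentialPhase.

(** * Discretization of polynomial phases *)

Section PhaseGrid.
Variable R : realType.
Local Notation ee := (@expi2pi R).

(** At integer arguments a coefficient matters only modulo 1, and an error [W ^ -j] in the
    coefficient of [X^j] varies the phase slowly for [t <= W]. The constant coefficient is a
    unimodular factor, so the grid fixes it to 0. *)
Fixpoint phase_grid (W d : nat) : seq {poly R} :=
  if d is d'.+1 then
    [seq g + (k%:R / (W ^ d)%:R) *: 'X^d | g <- phase_grid W d', k <- seq.iota 0 (W ^ d)]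
  else [:: 0].

Lemma size_phase_grid W d : size (phase_grid W d) = (W ^ (\sum_(j < d.+1) j))%N.
Proof.
elim: d => [|d IH]; first by rewrite big_ord_recr big_ord0 expn0.
by rewrite size_allpairs IH size_iota -expnD [in RHS]big_ord_recr.
Qed.

Lemma expnS_diff_le t d : (t.+1 ^ d.+1 <= t ^ d.+1 + d.+1 * t.+1 ^ d)%N.
Proof.
elim: d => [|d IH]; first by rewrite !expn1 expn0 muln1 addn1.
rewrite expnS mulSn addnC (expnS t).
have := leq_mul (leqnn t) IH; rewrite (expnS _ d).
move: (t.+1 ^ d)%N (t ^ d.+1)%N => u v h; nia.
Qed.

(** Dominates [2 pi (1 + ... + d)], the total of the variations left by rounding each
    coefficient. *)
Definition phase_const (d : nat) : R := 2 * pi * (d * d)%:R.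

Lemma phase_const_ge0 d : 0 <= phase_const d.
Proof. by rewrite !mulr_ge0 ?pi_ge0. Qed.

(** A leading coefficient splits into an integer, invisible to the phase, a grid value, and a
    remainder [dl <= W ^ -(d + 1)]. The remainder goes into [w], which it moves by at most
    [2 pi (d + 1) / W] per step. *)
Lemma phase_approx (W d : nat) (f : {poly R}) : (0 < W)%N -> (size f <= d.+1)%N ->
  exists2 g, g \in phase_grid W d & exists w : nat -> R[i]%C,
  [/\ forall t, cabs (w t) = 1,
      forall t : nat, ee f.[t%:R] = w t * ee g.[t%:R] &
      forall t, (t.+1 <= W)%N -> cabs (w t.+1 - w t) <= phase_const d / W%:R].
Proof.
move=> W_gt0; have W0 : 0 < W%:R :> R by rewrite ltr0n.
elim: d f => [|d IH] f szf.
  exists 0; first by rewrite inE.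
  exists (fun=> ee f`_0); split=> [t|t|t _]; first exact: cabs_expi2pi.
    by rewrite horner0 expi2pi0 mulr1 {1}(size1_polyC szf) hornerC.
  by rewrite subrr cabs0 divr_ge0 ?phase_const_ge0// ltW.
pose c := f`_d.+1; pose f' := f - c *: 'X^(d.+1).
have szf' : (size f' <= d.+1)%N.
  apply/leq_sizeP => j; rewrite leq_eqVlt => /orP[/eqP <-|dj].
    by rewrite coefB coefZ coefXn eqxx mulr1 subrr.
  rewrite coefB coefZ coefXn gtn_eqF// mulr0 subr0 nth_default//.
  by rewrite (leq_trans szf).
have [g gin [w [w1 wE weps]]] := IH f' szf'.
pose n := Num.floor c; pose Q := (W ^ d.+1)%N.
have Q_gt0 : (0 < Q)%N by rewrite expn_gt0 W_gt0.
have Q0 : 0 < Q%:R :> R by rewrite ltr0n.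
have cn : 0 <= c - n%:~R < 1.
  by rewrite subr_ge0 floor_le ltrBlDl; have := lt_succ_floor c; rewrite intrD.
have [cn0 cn1] := andP cn.
pose k := Num.trunc ((c - n%:~R) * Q%:R).
have /andP[k1 k2] : k%:R <= (c - n%:~R) * Q%:R < k.+1%:R.
  by apply: truncn_itv; rewrite mulr_ge0// ltW.
have kQ : (k < Q)%N.
  rewrite -(ltr_nat R); apply: (le_lt_trans k1).
  by rewrite -[X in _ < X]mul1r ltr_pM2r.
pose dl := c - n%:~R - k%:R / Q%:R.
have dl0 : 0 <= dl by rewrite subr_ge0 ler_pdivrMr.
have dlQ : dl * Q%:R <= 1.
  rewrite mulrBl divfK ?gt_eqF// lerBlDl natr1; exact: ltW.
exists (g + (k%:R / Q%:R) *: 'X^(d.+1)).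
  by apply/allpairsP; exists (g, k); split=> //=; rewrite mem_iota.
exists (fun t => w t * ee (dl * t%:R ^+ d.+1)); split=> [t|t|t tW].
- by rewrite cabsM w1 cabs_expi2pi mulr1.
- have -> : f.[t%:R] = f'.[t%:R] + (n%:~R * t%:R ^+ d.+1) +
      (k%:R / Q%:R) * t%:R ^+ d.+1 + dl * t%:R ^+ d.+1.
    rewrite /f' hornerD hornerN hornerZ hornerXn /dl; ring.
  have nE : n%:~R * t%:R ^+ d.+1 = (n * (t ^ d.+1)%N%:Z)%:~R :> R.
    by rewrite intrM -pmulrn natrX.
  rewrite !expi2piD wE nE expi2pi_int hornerD hornerZ hornerXn expi2piD.
  by ring.
- have -> : forall x y x' y' : R[i]%C, x' * y' - x * y = (x' - x) * y' + x * (y' - y).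
    by move=> *; ring.
  apply: (le_trans (cabs_leD _ _)); rewrite !cabsM cabs_expi2pi mulr1 w1 mul1r.
  apply: (@le_trans _ _ (phase_const d / W%:R + 2 * pi * (d.+1%:R / W%:R))).
    apply: lerD; first exact: weps.
    apply: (le_trans (cabs_expi2piB _ _)); rewrite ler_wpM2l ?mulr_ge0 ?pi_ge0//.
    rewrite -mulrBr normrM ger0_norm// -!natrX -natrB ?leq_exp2r// normr_nat.
    apply: (@le_trans _ _ (dl * (d.+1 * W ^ d)%:R)).
      rewrite ler_wpM2l// ler_nat leq_subLR (leq_trans (expnS_diff_le t d))//.
      by rewrite leq_add2l leq_mul2l /=; case: (d) => [//|d']; rewrite leq_exp2r.
    rewrite ler_pdivlMr// -mulrA -natrM -mulnA -expnSr -/Q natrM mulrCA.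
    by rewrite -[X in _ <= X]mulr1 ler_wpM2l.
  rewrite mulrA -mulrDl ler_wpM2r ?invr_ge0 ?(ltW W0)// /phase_const -mulrDr.
  by rewrite ler_wpM2l ?mulr_ge0 ?pi_ge0// -natrD ler_nat; nia.
Qed.
End PhaseGrid.

(** * A maximal function with small moments *)

Section ShortSumMaximal.
Variables (R : realType) (p : nat) (pr_p : prime p).
Variable chi : 'F_p -> R[i]%C.
Hypotheses (chiM : forall x y, chi (x * y) = chi x * chi y) (chi1 : chi 1 = 1).
Hypotheses (chi_sum0 : \sum_x chi x = 0) (chi0 : chi 0 = 0).
Variables (d r L : nat).
Hypotheses (r_gt0 : (0 < r)%N) (Lp : (2 ^ L <= p)%N).
Local Notation ee := (@expi2pi R).
Let W := (2 ^ L)%N.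

Let phased (g : {poly R}) (x : 'F_p) (t : nat) : R[i]%C := ee g.[t%:R] * chi (x + t%:R).

Definition block_energy (x : 'F_p) : R :=
  \sum_(g <- phase_grid R W d) \sum_(l < L) \sum_(j < 2 ^ (L - l))
    cabs (dyadic_block (phased g x) l j) ^+ (2 * r).

Lemma natr_Fp_inj m n : (m < p)%N -> (n < p)%N -> m%:R = n%:R :> 'F_p -> m = n.
Proof.
move=> mp np /(congr1 (@nat_of_ord _)); rewrite !val_Fp_nat//.
by rewrite !modn_small.
Qed.

(** [2 ^ L <= p] keeps the shifts in a block distinct modulo [p]. As
    [2 ^ (L - l) * (2 ^ l) ^ k <= W ^ k] for [k > 0], all blocks of a level together obey the bound
    for one block of length [W]. *)
Lemma block_energy_sum :
  \sum_x block_energy x <= (W ^ (\sum_(j < d.+1) j))%:R * (L%:R *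
    ((r ^ (2 * r))%:R * (p%:R * W%:R ^+ r)
     + (2 * r)%:R * (Num.sqrt p%:R * W%:R ^+ (2 * r)))).
Proof.
set Bd := (X in _ * (_ * X)).
rewrite /block_energy exchange_big /= -(size_phase_grid R).
apply: (@le_trans _ _ (\sum_(g <- phase_grid R W d) (L%:R * Bd))); last first.
  by rewrite big_const_seq count_predT iter_addr_0 -[X in X <= _]mulr_natl.
apply: ler_sum => g _; rewrite exchange_big /=.
apply: (@le_trans _ _ (\sum_(l < L) Bd)); last by rewrite sumr_const card_ord mulr_natl.
apply: ler_sum => l _; rewrite exchange_big /=.
have lL := ltnW (ltn_ord l).
pose Bl : R := (r ^ (2 * r))%:R * (p%:R * (2 ^ l)%:R ^+ r)
     + (2 * r)%:R * (Num.sqrt p%:R * (2 ^ l)%:R ^+ (2 * r)).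
apply: (@le_trans _ _ (\sum_(j < 2 ^ (L - l)) Bl)).
  apply: ler_sum => j _.
  pose b (t : 'I_(2 ^ l)) : 'F_p := (j * 2 ^ l + t)%:R.
  have jt (t : 'I_(2 ^ l)) : (j * 2 ^ l + t < p)%N.
    apply: leq_trans Lp.
    have <- : (2 ^ (L - l) * 2 ^ l = 2 ^ L)%N by rewrite -expnD subnK.
    have arith (u v j' t' : nat) : (t' < u)%N -> (j' < v)%N -> (j' * u + t' < v * u)%N by nia.
    exact: arith.
  have binj : injective b.
    by move=> t t' /(natr_Fp_inj (jt t) (jt t'))/addnI/val_inj.
  apply: (moment_bound pr_p chiM chi1 chi_sum0 chi0 binj (a := fun t => ee g.[(j * 2 ^ l + t)%:R])) => // t.
  by rewrite cabs_expi2pi.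
rewrite sumr_const card_ord -[X in X <= _]mulr_natl /Bl /Bd mulrDr.
have WE : W%:R = (2 ^ (L - l))%:R * (2 ^ l)%:R :> R by rewrite -natrM -expnD subnK.
have V1 : 1 <= (2 ^ (L - l))%:R :> R by rewrite ler1n expn_gt0.
have powle (k : nat) (x y : R) : (0 < k)%N -> 0 <= x -> 0 <= y ->
   (2 ^ (L - l))%:R * (x * (y * (2 ^ l)%:R ^+ k)) <= x * (y * W%:R ^+ k).
  move=> k_gt0 x0 y0; rewrite mulrCA ler_wpM2l// mulrCA ler_wpM2l// WE exprMn.
  rewrite ler_wpM2r ?exprn_ge0// -{1}[(2 ^ (L - l))%:R]expr1.
  by rewrite ler_weXn2l.
by apply: lerD; apply: powle; rewrite ?ler0n ?sqrtr_ge0 ?muln_gt0.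
Qed.

(** An [l^(2r)] norm replaces the maximum: [T x] dominates every block for every grid phase, yet its
    moment is a sum of single moments. *)
Lemma phased_sum_dominated : exists T : 'F_p -> R,
  [/\ forall x, 0 <= T x, forall x, T x ^+ (2 * r) = block_energy x &
   forall (f : {poly R}) (x : 'F_p) (M : nat), (size f <= d.+1)%N -> (M < W)%N ->
     cabs (\sum_(t < M) phased f x t) <= (1 + phase_const R d) * (L%:R * T x)].
Proof.
have en0 x : 0 <= block_energy x.
  by do 3 (apply: sumr_ge0 => ? _); rewrite exprn_ge0 ?cabs_ge0.
have r2 : (0 < 2 * r)%N by rewrite muln_gt0.
have ex x : exists y, 0 <= y /\ y ^+ (2 * r) = block_energy x.
  by have [y y0 yE] := root_power r2 (en0 x); exists y.
have [T TP] := choice ex.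
exists T; split=> [x|x|f x M szf MW]; [exact: (TP x).1|exact: (TP x).2|].
have [T0 TE] := TP x.
have W_gt0 : (0 < W)%N by rewrite expn_gt0.
have [g gin [w [w1 wE weps]]] := phase_approx W_gt0 szf.
have Bg n : (n <= M)%N -> cabs (\sum_(t < n) phased g x t) <= L%:R * T x.
  move=> nM.
  apply: (@prefix_le_dyadic_blocks _ (phased g x) (T x) L 0 n) => //; last exact: leq_ltn_trans MW.
  move=> l j lL; rewrite mul0n mul1n /= => jl.
  rewrite -(ler_pXn2r r2) ?nnegrE ?cabs_ge0// TE /block_energy.
  rewrite (big_rem g gin) /= (bigD1 (Ordinal lL)) //= (bigD1 (Ordinal jl)) //=.
  rewrite -!addrA ler_wpDr// !addr_ge0//; do ?[by apply: sumr_ge0 => ? _; rewrite exprn_ge0 ?cabs_ge0];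
    do ?[by do 2 (apply: sumr_ge0 => ? _); rewrite exprn_ge0 ?cabs_ge0];
    by do 3 (apply: sumr_ge0 => ? _); rewrite exprn_ge0 ?cabs_ge0.
have -> : \sum_(t < M) phased f x t = \sum_(t < M) w t * phased g x t.
  by apply: eq_bigr => t _; rewrite /phased wE mulrA.
have LT0 : 0 <= L%:R * T x by rewrite mulr_ge0.
apply: (@le_trans _ _ ((1 + M%:R * (phase_const R d / W%:R)) * (L%:R * T x))).
  apply: abel_bound => // t; first by rewrite w1.
  by move=> tM; apply: weps; rewrite (leq_trans tM)// ltnW.
rewrite ler_wpM2r// lerD2l mulrCA -[X in _ <= X]mulr1 ler_wpM2l ?phase_const_ge0//.
by rewrite ler_pdivrMr ?ltr0n// mul1r ler_nat ltnW.
Qed.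
End ShortSumMaximal.

(** * Hoelder's inequality and collisions of fractions *)

Section FiniteHoelder.
Variables (R : realFieldType) (I : finType) (nu : I -> R).
Hypothesis nu_ge0 : forall i, 0 <= nu i.

(** Symmetrized in [i] and [j], the difference of the two sides is half the double sum of [nu i * nu
    j * ((a i - a j) * (b i - b j))]. *)
Lemma chebyshev_sum (a b : I -> R) :
  (forall i j, 0 <= (a i - a j) * (b i - b j)) ->
  (\sum_i nu i * a i) * (\sum_i nu i * b i) <=
  (\sum_i nu i) * (\sum_i nu i * (a i * b i)).
Proof.
move=> ab; rewrite -subr_ge0.
have -> : (\sum_i nu i) * (\sum_i nu i * (a i * b i))
    - (\sum_i nu i * a i) * (\sum_i nu i * b i) =
    \sum_i \sum_j nu i * nu j * (b j * (a j - a i)).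
  rewrite !mulr_suml -sumrB; apply: eq_bigr => i _.
  rewrite !mulr_sumr -sumrB; apply: eq_bigr => j _; ring.
rewrite -(pmulrn_lge0 _ (ltn0Sn 1)) mulr2n {2}exchange_big -big_split /=.
apply: sumr_ge0 => i _; rewrite -big_split; apply: sumr_ge0 => j _ /=.
have -> : nu i * nu j * (b j * (a j - a i)) + nu j * nu i * (b i * (a i - a j)) =
  nu i * nu j * ((a i - a j) * (b i - b j)) by ring.
by apply: mulr_ge0 => //; exact: mulr_ge0.
Qed.

Lemma power_mean (y : I -> R) (k : nat) : (forall i, 0 <= y i) ->
  (\sum_i nu i * y i) ^+ k.+1 <= (\sum_i nu i) ^+ k * (\sum_i nu i * y i ^+ k.+1).
Proof.
move=> y0; elim: k => [|k IH]; first by rewrite expr0 mul1r.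
have s0 : 0 <= \sum_i nu i * y i by apply: sumr_ge0 => i _; rewrite mulr_ge0.
rewrite exprS; apply: (le_trans (ler_wpM2l s0 IH)).
rewrite mulrCA exprSr -mulrA ler_wpM2l ?exprn_ge0 ?sumr_ge0//.
under [X in _ <= _ * X]eq_bigr do rewrite exprS.
apply: chebyshev_sum => i j.
have [ij|ji] := leP (y i) (y j).
  by rewrite mulr_le0// subr_le0// lerXn2r ?nnegrE.
by rewrite mulr_ge0// subr_ge0 ?lerXn2r ?nnegrE// ltW.
Qed.

Lemma cauchy_sum (z : I -> R) :
  (\sum_i nu i * z i) ^+ 2 <= (\sum_i nu i ^+ 2) * (\sum_i z i ^+ 2).
Proof.
rewrite -subr_ge0 expr2.
have -> : (\sum_i nu i ^+ 2) * (\sum_i z i ^+ 2)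
    - (\sum_i nu i * z i) * (\sum_i nu i * z i) =
    \sum_i \sum_j (nu i * z j) * (nu i * z j - nu j * z i).
  rewrite !mulr_suml -sumrB; apply: eq_bigr => i _.
  rewrite !mulr_sumr -sumrB; apply: eq_bigr => j _; ring.
rewrite -(pmulrn_lge0 _ (ltn0Sn 1)) mulr2n {2}exchange_big -big_split /=.
apply: sumr_ge0 => i _; rewrite -big_split; apply: sumr_ge0 => j _ /=.
have -> : nu i * z j * (nu i * z j - nu j * z i) + nu j * z i * (nu j * z i - nu i * z j) =
  (nu i * z j - nu j * z i) ^+ 2 by ring.
exact: sqr_ge0.
Qed.

(** [power_mean] with exponent [r], then Cauchy-Schwarz on its square. In the application the second
    moment of [nu] counts collisions. *)
Lemma hoelder_sum (T : I -> R) (r : nat) : (0 < r)%N -> (forall i, 0 <= T i) ->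
  (\sum_i nu i * T i) ^+ (2 * r) <=
  (\sum_i nu i) ^+ (2 * r - 2) * ((\sum_i nu i ^+ 2) * (\sum_i T i ^+ (2 * r))).
Proof.
case: r => // k _ T0.
have -> : (2 * k.+1 - 2 = k * 2)%N by rewrite mulnS addKn mulnC.
rewrite mulnC exprM.
have s0 : 0 <= \sum_i nu i * T i by apply: sumr_ge0 => i _; rewrite mulr_ge0.
have s1 : 0 <= \sum_i nu i by apply: sumr_ge0.
have z0 : 0 <= \sum_i nu i * T i ^+ k.+1.
  by apply: sumr_ge0 => i _; rewrite mulr_ge0 ?exprn_ge0.
apply: (@le_trans _ _ (((\sum_i nu i) ^+ k * (\sum_i nu i * T i ^+ k.+1)) ^+ 2)).
  by rewrite lerXn2r ?nnegrE ?exprn_ge0 ?mulr_ge0 ?exprn_ge0// power_mean.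
rewrite exprMn -exprM ler_wpM2l ?exprn_ge0//.
under [X in _ <= _ * X]eq_bigr do rewrite exprM.
exact: cauchy_sum.
Qed.
End FiniteHoelder.

Lemma harmonic_le (R : realType) (A : nat) : (0 < A)%N ->
  \sum_(1 <= g < A.+1) g%:R^-1 <= 1 + ln A%:R :> R.
Proof.
case: A => // A _; elim: A => [|A IH]; first by rewrite big_nat1 invr1 ln1 addr0.
rewrite big_nat_recr //=; apply: (le_trans (lerD IH (lexx _))).
rewrite -addrA lerD2l -lerBrDl.
have a0 : 0 < A.+1%:R :> R by rewrite ltr0n.
have b0 : 0 < A.+2%:R :> R by rewrite ltr0n.
rewrite -ln_div ?posrE// -[X in _ <= X]opprK -lnV ?posrE ?divr_gt0// invf_div.
rewrite lerNr.
have -> : A.+1%:R / A.+2%:R = 1 + (- A.+2%:R^-1) :> R.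
  by rewrite -[A.+1%:R](addrK 1) natr1 mulrBl divff ?gt_eqF// mul1r.
by apply: le_ln1Dx; rewrite ltrN2 invf_lt1// ltr1n.
Qed.

Lemma gcd_le_common_divisors (A a b : nat) : (0 < a <= A)%N ->
  (gcdn a b <= \sum_(1 <= g < A.+1 | (g %| a) && (g %| b)) g)%N.
Proof.
move=> /andP[a0 aA].
rewrite big_mkcond (bigD1_seq (gcdn a b)) ?iota_uniq ?mem_index_iota//=; last first.
  by rewrite gcdn_gt0 a0 ltnS (leq_trans (dvdn_leq a0 (dvdn_gcdl _ _))).
by rewrite dvdn_gcdl dvdn_gcdr /= leq_addr.
Qed.

Lemma count_multiples (g A : nat) : (0 < g)%N ->
  (\sum_(1 <= a < A.+1 | g %| a) 1 = A %/ g)%N.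
Proof.
move=> g0; elim: A => [|A IH]; first by rewrite big_geq ?div0n.
rewrite big_mkcond big_nat_recr //= -big_mkcond IH.
rewrite (divnS A g0) addnC; congr (_ + _)%N.
Qed.

(** Replace the gcd by the sum of all common divisors. Each divisor [g] of [a] then contributes
    [g * (a / g) = a] to the sum over [b], so the inner sum is at most the number of divisors of
    [a]; summed over [a], this gives [A] times a harmonic sum. *)
Lemma sum_gcd_ratio (R : realType) (A : nat) : (0 < A)%N ->
  \sum_(1 <= a < A.+1) \sum_(1 <= b < a.+1) (gcdn a b)%:R / a%:R
  <= A%:R * (1 + ln A%:R) :> R.
Proof.
move=> A0.
apply: (@le_trans _ _ (\sum_(1 <= a < A.+1) (\sum_(1 <= g < A.+1 | g %| a) 1)%N%:R)).
  apply: ler_sum_nat => a /andP[a0 aA]; rewrite ltnS in aA.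
  have a0R : 0 < a%:R :> R by rewrite ltr0n.
  rewrite -mulr_suml ler_pdivrMr// -natr_sum -natrM ler_nat.
  apply: (@leq_trans (\sum_(1 <= b < a.+1) \sum_(1 <= g < A.+1 | (g %| a) && (g %| b)) g)%N).
    by apply: leq_sum => b _; apply: gcd_le_common_divisors; rewrite a0.
  rewrite (exchange_big_dep (fun g => (g %| a)%N)) /=; last by move=> b g _ /andP[].
  rewrite big_distrl /= big_nat_cond [X in (_ <= X)%N]big_nat_cond.
  apply: leq_sum => g /andP[/andP[g0 _] ga].
  under eq_bigl do rewrite ga /=.
  rewrite (eq_bigr (fun=> (g * 1)%N)) => [|i _]; last by rewrite muln1.
  by rewrite -big_distrr /= count_multiples// mul1n mulnC divnK.
rewrite -natr_sum (exchange_big_dep_nat xpredT) //= natr_sum.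
apply: (@le_trans _ _ (\sum_(1 <= g < A.+1) A%:R * g%:R^-1)).
  apply: ler_sum_nat => g /andP[g0 _]; rewrite count_multiples//.
  by rewrite ler_pdivlMr ?ltr0n// -natrM ler_nat leq_trunc_div.
by rewrite -mulr_sumr ler_wpM2l// harmonic_le.
Qed.

Lemma coprime_mod_cancel (w w' m n : nat) : coprime w w' ->
  w' * m = w' * n %[mod w] -> m = n %[mod w].
Proof.
move=> cop; wlog nm : m n / (n <= m)%N => [hw|].
  by have [/hw//|/ltnW/hw h] := leqP n m => /esym/h.
by move=> /eqP; rewrite !eqn_mod_dvd ?leq_mul// -mulnBr Gauss_dvdr// -eqn_mod_dvd// => /eqP.
Qed.

(** The equation forces [i1] and [j1] to agree modulo [w = a / gcdn a b], and the last hypothesis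
    puts them in the same interval of length [w]. *)
Lemma equal_fractions_solution (a b i1 i2 j1 j2 : nat) : (0 < a)%N ->
  (a * i2 + b * j1 = a * j2 + b * i1)%N ->
  (i1 %/ (a %/ gcdn a b) = j1 %/ (a %/ gcdn a b))%N -> i1 = j1 /\ i2 = j2.
Proof.
move=> a0 E; set g := gcdn a b; set w := (a %/ g)%N => Ew.
have g0 : (0 < g)%N by rewrite gcdn_gt0 a0.
have aE : a = (w * g)%N by rewrite divnK ?dvdn_gcdl.
have bE : b = (b %/ g * g)%N by rewrite divnK ?dvdn_gcdr.
have cop : coprime w (b %/ g).
  by rewrite /coprime -(eqn_pmul2r g0) mul1n muln_gcdl -aE -bE.
have E' : (w * i2 + b %/ g * j1 = w * j2 + b %/ g * i1)%N.
  apply/eqP; rewrite -(eqn_pmul2r g0) !mulnDl.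
  by rewrite ![(_ * _ * g)%N]mulnAC -aE -bE E.
have m1 : j1 = i1 %[mod w].
  apply: (coprime_mod_cancel cop).
  by have := congr1 (modn^~ w) E'; rewrite !(mulnC w) !modnMDl.
have i1E : i1 = j1 by rewrite (divn_eq i1 w) (divn_eq j1 w) m1 Ew.
split=> //; apply/eqP; rewrite -(eqn_pmul2l a0); apply/eqP.
by move: E; rewrite i1E => /addIn.
Qed.

(** * Collisions of the fractions [n / a] modulo [p] *)

Section FiberCount.
Variables (p : nat) (pr_p : prime p).

(** [K - i] keeps the linear form a natural number, at most [(a + b) K]. Within a residue class its
    quotient by [p] fixes its value, and for a fixed value [i %/ w] determines the pair. *)
Lemma count_congruent (a b K : nat) (rho : 'F_p) : (0 < a)%N ->
  (\sum_(i < K) \sum_(j < K) (((a * j + b * (K - i))%:R : 'F_p) == rho)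
    <= (((a + b) * K) %/ p).+1 * (K %/ (a %/ gcdn a b)).+1)%N.
Proof.
move=> a0; rewrite pair_bigA /=.
set w := (a %/ gcdn a b)%N; set X := ((a + b) * K %/ p)%N; set Y := (K %/ w)%N.
pose u (ij : 'I_K * 'I_K) := (a * ij.2 + b * (K - ij.1))%N.
pose S := [set ij : 'I_K * 'I_K | ((u ij)%:R : 'F_p) == rho]%SET.
have -> : (\sum_(ij : 'I_K * 'I_K) (((a * ij.2 + b * (K - ij.1))%:R : 'F_p) == rho) = #|S|)%N.
  rewrite -sum1_card [RHS]big_mkcond /=; apply: eq_bigr => ij _.
  by rewrite inE; case: (_ == rho).
pose h (ij : 'I_K * 'I_K) : 'I_X.+1 * 'I_Y.+1 := (inord (u ij %/ p), inord (ij.1 %/ w)).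
have uX ij : (u ij %/ p < X.+1)%N.
  rewrite ltnS leq_div2r// /u mulnDl leq_add// leq_mul2l ?leq_subr ?orbT//.
  by rewrite ltnW ?orbT.
have iY (i : 'I_K) : (i %/ w < Y.+1)%N by rewrite ltnS leq_div2r// ltnW.
rewrite -(card_ord X.+1) -(card_ord Y.+1) -card_prod.
suff hinj : {in S &, injective h} by rewrite -(card_in_imset hinj) max_card.
move=> [i1 i2] [j1 j2]; rewrite !inE => /eqP ui /eqP uj [hu hi].
have {}hu : (u (i1, i2) %/ p = u (j1, j2) %/ p)%N.
  by have := congr1 (@nat_of_ord _) hu; rewrite !inordK.
have {}hi : (i1 %/ w = j1 %/ w)%N.
  by have := congr1 (@nat_of_ord _) hi; rewrite !inordK.
have um : (u (i1, i2) %% p = u (j1, j2) %% p)%N.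
  by rewrite -!(val_Fp_nat pr_p) ui uj.
have uE : u (i1, i2) = u (j1, j2) by rewrite (divn_eq (u (i1, i2)) p) hu um -divn_eq.
have E : (a * i2 + b * j1 = a * j2 + b * i1)%N.
  have := uE; rewrite /u /=.
  have := ltn_ord i1; have := ltn_ord j1.
  move: (nat_of_ord i1) (nat_of_ord i2) (nat_of_ord j1) (nat_of_ord j2) => x y z t zK xK.
  have aux (P Q U V Z : nat) : (U <= Z)%N -> (V <= Z)%N ->
      (P + (Z - U) = Q + (Z - V))%N -> (P + V = Q + U)%N by clear; lia.
  rewrite !mulnBr; apply: aux; rewrite leq_mul2l ltnW ?orbT//.
have [] := equal_fractions_solution a0 E hi.
by move=> /val_inj -> /val_inj ->.
Qed.

Variables (R : realType) (A K : nat) (n0 : int).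
Hypotheses (Ap : (A < p)%N) (A_gt0 : (0 < A)%N).

Definition ratio (z : 'I_A * 'I_K) : 'F_p := (n0 + z.2%:Z)%:~R / z.1.+1%:R.

Let N (a b : 'I_A) := (\sum_(i < K) \sum_(j < K) (ratio (a, i) == ratio (b, j)))%N.

Let natr_neq0 (a : 'I_A) : a.+1%:R != 0 :> 'F_p.
Proof.
apply/eqP => /(congr1 (@nat_of_ord _)); rewrite val_Fp_nat// modn_small//.
exact: leq_ltn_trans Ap.
Qed.

(** Clearing denominators turns a collision into [a j + b (K - i) = rho] in ['F_p]. *)
Let N_le (a b : 'I_A) :
  (N a b <= (((a.+1 + b.+1) * K) %/ p).+1 * (K %/ (a.+1 %/ gcdn a.+1 b.+1)).+1)%N.
Proof.
pose rho : 'F_p := (b.+1%:R - a.+1%:R) * n0%:~R + (b.+1 * K)%:R.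
apply: leq_trans (count_congruent b.+1 K rho (ltn0Sn a)).
apply: leq_sum => i _; apply: leq_sum => j _.
case: eqP => //= xE; rewrite lt0b; apply/eqP.
have bi : b.+1%:R * (n0%:~R + i%:R) = a.+1%:R * (n0%:~R + j%:R) :> 'F_p.
  move: xE; rewrite /ratio /= !intrD -!pmulrn => /(congr1 (fun y => y * (a.+1%:R * b.+1%:R))).
  rewrite mulrA divfK ?natr_neq0// [a.+1%:R * b.+1%:R]mulrC mulrA divfK ?natr_neq0//.
  by rewrite mulrC => ->; rewrite mulrC.
have iK := ltnW (ltn_ord i).
rewrite natrD natrM natrM natrB// /rho natrM.
have -> : a.+1%:R * j%:R = b.+1%:R * (n0%:~R + i%:R) - a.+1%:R * n0%:~R :> 'F_p.
  by rewrite bi mulrDr addrC addKr.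
by ring.
Qed.

Let N_sym a b : N a b = N b a.
Proof.
rewrite /N exchange_big /=; apply: eq_bigr => i _; apply: eq_bigr => j _.
by rewrite eq_sym.
Qed.

(** Symmetry reduces to [b <= a] at the price of the factor 2; the terms [K gcd(a, b) / a] are then
    summed by [sum_gcd_ratio], and the terms 1 give [A ^ 2]. *)
Lemma ratio_collisions :
  (\sum_(z1 : 'I_A * 'I_K) \sum_(z2 : 'I_A * 'I_K) (ratio z1 == ratio z2))%N%:R
  <= 2 * ((2 * A * K) %/ p).+1%:R * (K%:R * (A%:R * (1 + ln A%:R)) + A%:R ^+ 2) :> R.
Proof.
have -> : (\sum_(z1 : 'I_A * 'I_K) \sum_(z2 : 'I_A * 'I_K) (ratio z1 == ratio z2) =
    \sum_(a < A) \sum_(b < A) N a b)%N.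
  rewrite -(pair_bigA _ (fun a i => \sum_(z2 : 'I_A * 'I_K) (ratio (a, i) == ratio z2))%N) /=.
  apply: eq_bigr => a _; rewrite [RHS]exchange_big /=; apply: eq_bigr => i _.
  by rewrite -(pair_bigA _ (fun b j => nat_of_bool (ratio (a, i) == ratio (b, j)))).
set X := ((2 * A * K) %/ p).+1.
apply: (@le_trans _ _ (2 * \sum_(a < A) \sum_(b < A | (b <= a)%N) (N a b)%:R)).
  rewrite mulr_natl mulr2n.
  have -> : (\sum_(a < A) \sum_(b < A) N a b =
    \sum_(a < A) \sum_(b < A | b <= a) N a b + \sum_(a < A) \sum_(b < A | b < a) N a b)%N.
    rewrite [in X in (_ + X)%N](exchange_big_dep xpredT) //= -big_split /=.
    apply: eq_bigr => a _; rewrite (bigID (fun b : 'I_A => b <= a)%N) /=; congr (_ + _)%N.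
    by apply: eq_big => [b|b _]; rewrite ?ltnNge// N_sym.
  rewrite natrD !natr_sum; apply: lerD.
    by apply: ler_sum => a _; rewrite natr_sum.
  apply: ler_sum => a _; rewrite natr_sum [X in _ <= X](bigID (fun b : 'I_A => b < a)%N) /=.
  rewrite -[X in X <= _]addr0; apply: lerD; last by apply: sumr_ge0.
  by rewrite le_eqVlt; apply/orP; left; apply/eqP/eq_bigl => b; case: ltngtP.
rewrite -mulrA ler_pM2l//.
have bound (a b : 'I_A) : (b <= a)%N ->
    (N a b)%:R <= X%:R * (K%:R * ((gcdn a.+1 b.+1)%:R / a.+1%:R) + 1) :> R.
  move=> ba; apply: (@le_trans _ _ (X * (K %/ (a.+1 %/ gcdn a.+1 b.+1)).+1)%:R).
    rewrite ler_nat (leq_trans (N_le a b))// leq_mul2r ltnS leq_div2r ?orbT//.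
    by rewrite leq_mul2r mul2n -addnn leq_add ?orbT.
  rewrite natrM ler_wpM2l// -natr1 lerD2r.
  set g := gcdn a.+1 b.+1.
  have g0 : (0 < g)%N by rewrite gcdn_gt0.
  have w0 : (0 < a.+1 %/ g)%N by rewrite divn_gt0// dvdn_leq// dvdn_gcdl.
  have aE : a.+1%:R = (a.+1 %/ g)%:R * g%:R :> R by rewrite -natrM divnK// dvdn_gcdl.
  rewrite aE [_ * g%:R]mulrC invfM [g%:R * _]mulrA divff ?pnatr_eq0 -?lt0n// mul1r.
  by rewrite ler_pdivlMr ?ltr0n// -natrM ler_nat leq_trunc_div.
apply: (@le_trans _ _ (\sum_(a < A) \sum_(b < A | (b <= a)%N)
    X%:R * (K%:R * ((gcdn a.+1 b.+1)%:R / a.+1%:R) + 1))).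
  by apply: ler_sum => a _; apply: ler_sum => b; exact: bound.
under eq_bigr do rewrite -mulr_sumr big_split /= -mulr_sumr.
rewrite -mulr_sumr ler_wpM2l// big_split /= -mulr_sumr; apply: lerD.
  rewrite ler_wpM2l//; apply: le_trans (sum_gcd_ratio R A_gt0).
  rewrite le_eqVlt; apply/orP; left; apply/eqP.
  rewrite big_add1 /= big_mkord; apply: eq_bigr => a _.
  rewrite big_add1 /= big_mkord.
  by rewrite (big_ord_widen A (fun b => (gcdn a.+1 b.+1)%:R / a.+1%:R : R) (ltn_ord a)).
apply: (@le_trans _ _ (\sum_(a < A) \sum_(b < A) 1)); last first.
  by rewrite !sumr_const card_ord -mulrnA natrM expr2.
apply: ler_sum => a _; rewrite [X in _ <= X](bigID (fun b : 'I_A => b <= a)%N) /=.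
by rewrite lerDl sumr_ge0.
Qed.
End FiberCount.

(** * Burgess's argument *)

Section CharacterModPrime.
Variables (R : realType) (q : nat) (chi : int -> R[i]%C).
Hypotheses (pr_q : prime q) (dchi : dirichlet_character q chi).

Definition char_Fp (x : 'F_q) : R[i]%C := chi (nat_of_ord x)%:Z.

Lemma dirichlet_addMn n (k : nat) : chi (n + k%:Z * q%:Z) = chi n.
Proof.
have [per _ _] := dchi; elim: k => [|k IH]; first by rewrite mul0r addr0.
by rewrite -addn1 PoszD mulrDl mul1r addrA per.
Qed.

Lemma dirichlet_addMz n k : chi (n + k * q%:Z) = chi n.
Proof.
case: k => k; first exact: dirichlet_addMn.
by have := dirichlet_addMn (n + Negz k * q%:Z) k.+1; rewrite NegzE mulNr subrK => ->.
Qed.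

Lemma char_FpE n : chi n = char_Fp n%:~R.
Proof.
have q0 : q%:Z != 0 by rewrite eqz_nat -lt0n prime_gt0.
pose m := `|(n %% q%:Z)%Z|%N.
have mE : (n %% q%:Z)%Z = m%:Z by rewrite gez0_abs ?modz_ge0.
have mq : (m < q)%N by rewrite -ltz_nat -mE ltz_pmod// ltz_nat prime_gt0.
have nE := divz_eq n q%:Z; rewrite mE in nE.
rewrite nE addrC dirichlet_addMz /char_Fp; congr (chi _%:Z).
have q0F : (q%:Z%:~R : 'F_q) = 0.
  by rewrite -pmulrn; apply: val_inj; rewrite /= val_Fp_nat// modnn.
by rewrite intrD intrM q0F mulr0 addr0 -pmulrn val_Fp_nat// modn_small.
Qed.

Lemma char_FpM x y : char_Fp (x * y) = char_Fp x * char_Fp y.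
Proof.
have [_ mul _] := dchi.
have -> : x * y = ((nat_of_ord x)%:Z * (nat_of_ord y)%:Z)%:~R.
  by rewrite intrM -!pmulrn !natr_Zp.
by rewrite -char_FpE mul.
Qed.

Lemma char_Fp0 : char_Fp 0 = 0.
Proof.
have [_ _ cop] := dchi; apply/eqP/negPn/negP => /cop.
rewrite /coprimez gcd0z => /eqP [q1].
by have := prime_gt1 pr_q; rewrite q1.
Qed.

Lemma char_Fp1 : char_Fp 1 = 1.
Proof.
have [_ mul cop] := dchi.
have c1 : chi 1 != 0 by apply/cop; rewrite /coprimez gcd1z.
have -> : char_Fp 1 = chi 1 by rewrite char_FpE.
by apply: (mulfI c1); rewrite -mul !mulr1.
Qed.

Lemma char_Fp_sum0 : ~ (chi =1 principal_character R q) -> \sum_x char_Fp x = 0.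
Proof.
move=> nprin; have [_ _ cop] := dchi.
have [n chin] : exists n, chi n <> principal_character R q n.
  by apply: contrapT => /forallNP h; apply: nprin => n; apply: contrapT; exact: h.
have [cn|ncn] := boolP (coprimez n q%:Z); last first.
  case: chin; rewrite /principal_character (negPf ncn); apply/eqP/negPn/negP => /cop.
  by rewrite (negPf ncn).
have y0 : (n%:~R : 'F_q) != 0.
  by apply/eqP => y0; have /cop := cn; rewrite char_FpE y0 char_Fp0 eqxx.
have y1 : char_Fp n%:~R != 1.
  by rewrite -char_FpE; apply/eqP => h; apply: chin; rewrite h /principal_character cn.
have : \sum_x char_Fp x = char_Fp n%:~R * \sum_x char_Fp x.
  rewrite mulr_sumr {1}(reindex_inj (mulfI y0)); apply: eq_bigr => x _.
  by rewrite char_FpM.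
move=> /eqP; rewrite -{1}[\sum_x _]mul1r -subr_eq0 -mulrBl mulf_eq0 subr_eq0 eq_sym.
by rewrite (negPf y1) => /eqP.
Qed.
End CharacterModPrime.

(** * Windows, initial segments and translations *)

Lemma window_sum (R : realType) (F : int -> R[i]%C) (N H : R) : 1 <= H ->
  exists (n1 : int) (h : nat), h%:R <= H + 1 /\
    \sum_(n \in int_window N H) F n = \sum_(i < h) F (n1 + i%:Z).
Proof.
move=> H1; pose n0 := Num.floor N; pose n2 := Num.floor (N + H).
have n02 : n0 <= n2.
  by apply: le_floor; rewrite lerDl (le_trans ler01).
pose h := `|n2 - n0|%N.
have hE : n2 = n0 + h%:Z by rewrite gez0_abs ?subr_ge0// [RHS]addrC subrK.
exists (n0 + 1), h; split.
  have : n2%:~R <= N + H by exact: floor_le.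
  have : N < n0%:~R + 1 by have := lt_succ_floor N; rewrite intrD.
  rewrite hE intrD -pmulrn; lra.
rewrite (fsbig_ord _ _ (fun i => F (n0 + 1 + i%:Z))).
rewrite (reindex_fsbig (fun i : nat => n0 + 1 + i%:Z) (`I_h)%classic) //.
split=> [i /= ih|i j _ _ /addrI[]//|n /= /andP[Nn nNH]].
  rewrite /int_window /= -floor_ge_int -/n2 hE -floor_lt_int.
  by rewrite -/n0; move: (n0) (h) ih => u v iv; clear -iv; lia.
have nlt : n0 < n by rewrite /n0 floor_lt_int.
have nle : n <= n2 by rewrite /n2 floor_ge_int.
exists `|(n - (n0 + 1))%R|%N; last by rewrite gez0_abs; lia.
by rewrite /= -ltz_nat gez0_abs; lia.
Qed.

Lemma initial_segment_sum (V : zmodType) (F : nat -> V) (P : pred nat) (W : nat) :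
  (forall t, P t.+1 -> P t) ->
  exists2 tau, (tau <= W)%N & \sum_(t < W | P t) F t = \sum_(t < tau) F t.
Proof.
move=> mono; elim: W => [|W [tau tauW IH]]; first by exists 0%N; rewrite ?big_ord0.
have [PW|nPW] := boolP (P W).
  exists W.+1 => //; apply: eq_bigl => t.
  have allP k : (k <= W)%N -> P (W - k)%N.
    elim: k => [|k IHk kW]; first by rewrite subn0.
    by apply: mono; rewrite -subSn// subSS IHk// ltnW.
  by rewrite -(subKn (leq_ord t)) allP// leq_subr.
exists tau; first exact: leqW.
by rewrite big_mkcond big_ord_recr /= (negPf nPW) addr0 -big_mkcond.
Qed.

(** The range [k < B + h] is the same for all shifts [s <= B], so that the sums over [k] and over
    the shifts can be exchanged. *)
Lemma shifted_interval_sum (V : zmodType) (G : nat -> V) (B h s : nat) : (s <= B)%N ->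
  \sum_(i < h) G (B + i)%N = \sum_(k < B + h | (B <= k + s < B + h)%N) G (k + s)%N.
Proof.
move=> sB.
rewrite -(big_mkord xpredT (fun i => G (B + i)%N)).
rewrite -(big_mkord (fun k => B <= k + s < B + h)%N (fun k => G (k + s)%N)).
have -> : \sum_(0 <= i < h) G (B + i)%N = \sum_(B <= j < B + h) G j.
  rewrite -{2}[B]add0n big_addn addKn; apply: eq_bigr => i _.
  by rewrite addnC.
have -> : \sum_(0 <= k < B + h | (B <= k + s < B + h)%N) G (k + s)%N =
    \sum_(s <= j < B + h + s | (B <= j < B + h)%N) G j.
  rewrite [RHS](_ : _ = \sum_(0 + s <= j < B + h + s | (B <= j < B + h)%N) G j); last by rewrite add0n.
  by rewrite [RHS]big_addn addnK.
rewrite [in RHS](big_cat_nat (n := B) (m := s) (p := B + h + s))//=; last by rewrite -addnA leq_addr.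
rewrite [X in _ = X + _]big_nat_cond [X in _ = X + _]big1 ?add0r; last first.
  by move=> j /andP[/andP[_ jB] /andP[Bj _]]; move: jB; rewrite ltnNge Bj.
rewrite [in RHS](big_cat_nat (n := B + h) (m := B)) ?leq_addr//=.
rewrite [X in _ = _ + X]big_nat_cond [X in _ = _ + X]big1 ?addr0; last first.
  by move=> j /andP[/andP[jB _]] /andP[_]; rewrite ltnNge jB.
rewrite big_nat_cond [RHS]big_nat_cond; apply: eq_bigl => j.
by case: (B <= j < B + h)%N.
Qed.

(** * The shift by products and its [2 r]-th power *)

Section BurgessShift.
Variables (R : realType) (p : nat) (pr_p : prime p).
Variable chi : 'F_p -> R[i]%C.
Hypotheses (chiM : forall x y, chi (x * y) = chi x * chi y) (chi1 : chi 1 = 1).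
Hypotheses (chi_sum0 : \sum_x chi x = 0) (chi0 : chi 0 = 0).
Variables (d r L A h : nat) (f : {poly R}) (n1 : int).
Hypotheses (r_gt0 : (0 < r)%N) (L_gt0 : (0 < L)%N) (Lp : (2 ^ L <= p)%N).
Hypotheses (Ap : (A < p)%N) (A_gt0 : (0 < A)%N) (szf : (size f <= d.+1)%N).
Local Notation ee := (@expi2pi R).
(** One less than a power of 2, as the maximal function dominates sums of length strictly below
    [2 ^ L]. [B] bounds every shift [a t], and [nn] moves the origin to make all indices natural
    numbers. *)
Let W := (2 ^ L - 1)%N.
Let B := (A * W)%N.
Let K := (B + h)%N.
Let nn : int := n1 - B%:Z.
Let G (k : nat) : R[i]%C := ee f.[(nn + k%:Z)%:~R] * chi (nn + k%:Z)%:~R.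
Let S : R[i]%C := \sum_(i < h) ee f.[(n1 + i%:Z)%:~R] * chi (n1 + i%:Z)%:~R.

Let S_G : S = \sum_(i < h) G (B + i)%N.
Proof. by apply: eq_bigr => i _; rewrite /G /nn PoszD addrA subrK. Qed.

Let phased (g : {poly R}) (x : 'F_p) (t : nat) : R[i]%C := ee g.[t%:R] * chi (x + t%:R).

Let natr_neq0 (a : 'I_A) : a.+1%:R != 0 :> 'F_p.
Proof.
apply/eqP => /(congr1 (@nat_of_ord _)); rewrite val_Fp_nat// modn_small//.
exact: leq_ltn_trans Ap.
Qed.

(** [chi (n + a t) = chi a * chi (n / a + t)], while [f (n + a t)] is a polynomial in [t] of the
    same degree. *)
Let G_shift (a : 'I_A) (k : 'I_K) (t : nat) :
  G (k + a.+1 * t)%N = chi a.+1%:R *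
    phased (f \Po (a.+1%:R *: 'X + ((nn + k%:Z)%:~R)%:P)) (ratio p nn (a, k)) t.
Proof.
rewrite /G /phased horner_comp hornerD hornerZ hornerX hornerC mulrCA -chiM.
have key (F : nzRingType) : (nn + (k + a.+1 * t)%N%:Z)%:~R =
    (nn + k%:Z)%:~R + a.+1%:R * t%:R :> F.
  by rewrite PoszD PoszM !intrD intrM addrA -!pmulrn.
rewrite !key [X in f.[X]]addrC; congr (_ * chi _).
by rewrite /ratio mulrDr [a.+1%:R * (_ / _)]mulrC divfK ?natr_neq0.
Qed.

(** For fixed [a] and [k] the admissible [t] form a difference of two initial segments, hence the
    factor 2. *)
Lemma shifted_sum_bound (T : 'F_p -> R) (c : R) :
  (forall (g : {poly R}) (x : 'F_p) (M : nat), (size g <= d.+1)%N -> (M < 2 ^ L)%N ->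
     cabs (\sum_(t < M) phased g x t) <= c * T x) ->
  A%:R * W%:R * cabs S <=
    2 * c * \sum_x (\sum_(z : 'I_A * 'I_K) (ratio p nn z == x))%N%:R * T x.
Proof.
move=> domT.
have one (a : 'I_A) : W%:R * cabs S <= \sum_(k < K) 2 * c * T (ratio p nn (a, k)).
  have -> : W%:R * cabs S = cabs (\sum_(t < W) S).
    by rewrite sumr_const card_ord -[S *+ W]mulr_natl cabsM cabs_nat.
  have -> : \sum_(t < W) S =
      \sum_(k < K) \sum_(t < W | (B <= k + a.+1 * t < K)%N) G (k + a.+1 * t)%N.
    rewrite [RHS](exchange_big_dep xpredT) //=; apply: eq_bigr => t _.
    rewrite S_G; apply: shifted_interval_sum; rewrite leq_mul//.
    by rewrite ltnW.
  apply: (le_trans (cabs_le_sum _ _ _)); apply: ler_sum => k _.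
  pose F t := G (k + a.+1 * t)%N.
  have -> : \sum_(t < W | (B <= k + a.+1 * t < K)%N) F t =
     \sum_(t < W | (k + a.+1 * t < K)%N) F t - \sum_(t < W | (k + a.+1 * t < B)%N) F t.
    rewrite [X in _ = X - _](bigID (fun t : 'I_W => (k + a.+1 * t < B)%N)) /=.
    rewrite [X in _ = X + _ - _](eq_bigl (fun t : 'I_W => (k + a.+1 * t < B)%N)).
      rewrite addrAC subrr add0r; apply: eq_bigl => t.
      by rewrite -leqNgt andbC.
    move=> t; rewrite andb_idl// => lt_B; exact: leq_trans lt_B (leq_addr _ _).
  have mono c0 t : (k + a.+1 * t.+1 < c0)%N -> (k + a.+1 * t < c0)%N.
    by apply: leq_ltn_trans; rewrite leq_add2l leq_mul2l leqnSn orbT.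
  have prefix tau : (tau <= W)%N -> cabs (\sum_(t < tau) F t) <= c * T (ratio p nn (a, k)).
    move=> tauW.
    under eq_bigr do rewrite /F G_shift.
    rewrite -mulr_sumr cabsM.
    apply: (@le_trans _ _ (1 * (c * T (ratio p nn (a, k))))); last by rewrite mul1r.
    apply: ler_pM; rewrite ?cabs_ge0//; first exact: cabs_chi_le1.
    apply: domT; last by rewrite (leq_ltn_trans tauW)// /W subn1 prednK ?expn_gt0.
    rewrite size_comp_poly2// size_polyDl size_scale ?pnatr_eq0// size_polyX//.
    by rewrite size_polyC; case: (_ != 0).
  have [t1 t1W ->] := initial_segment_sum F W (mono K).
  have [t2 t2W ->] := initial_segment_sum F W (mono B).
  apply: (le_trans (cabs_leB _ _)); rewrite -mulrA mulr_natl mulr2n.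
  by apply: lerD; exact: prefix.
have -> : A%:R * W%:R * cabs S = \sum_(a < A) W%:R * cabs S.
  by rewrite sumr_const card_ord -mulrA mulr_natl.
apply: (@le_trans _ _ (\sum_(a < A) \sum_(k < K) 2 * c * T (ratio p nn (a, k)))).
  by apply: ler_sum => a _; exact: one.
rewrite pair_bigA /= -mulr_sumr.
have -> // : \sum_(z : 'I_A * 'I_K) T (ratio p nn (z.1, z.2)) =
  \sum_x (\sum_(z : 'I_A * 'I_K) (ratio p nn z == x))%N%:R * T x.
under [RHS]eq_bigr do rewrite natr_sum mulr_suml.
rewrite exchange_big /=; apply: eq_bigr => -[a k] _ /=.
rewrite (bigD1 (ratio p nn (a, k)))//= eqxx mul1r big1 ?addr0// => x.
by rewrite eq_sym => /negPf ->; rewrite mul0r.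
Qed.

(** Hoelder's inequality for the counting function [nu] of the fractions: its mass is [A K], and its
    square sum is the number of collisions. *)
Lemma burgess_power_bound :
  (A%:R * W%:R * cabs S) ^+ (2 * r) <=
  (2 * ((1 + phase_const R d) * L%:R)) ^+ (2 * r) *
  ((A%:R * K%:R) ^+ (2 * r - 2) *
   ((2 * ((2 * A * K) %/ p).+1%:R * (K%:R * (A%:R * (1 + ln A%:R)) + A%:R ^+ 2)) *
    (((2 ^ L) ^ (\sum_(j < d.+1) j))%:R * (L%:R *
    ((r ^ (2 * r))%:R * (p%:R * (2 ^ L)%:R ^+ r)
     + (2 * r)%:R * (Num.sqrt p%:R * (2 ^ L)%:R ^+ (2 * r))))))).
Proof.
have [T [T0 TE Tdom]] := phased_sum_dominated chi d L r_gt0.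
pose c : R := (1 + phase_const R d) * L%:R.
have c0 : 0 <= c by rewrite mulr_ge0 ?addr_ge0 ?phase_const_ge0.
have domT (g : {poly R}) (x : 'F_p) (M : nat) : (size g <= d.+1)%N -> (M < 2 ^ L)%N ->
     cabs (\sum_(t < M) phased g x t) <= c * T x.
  by move=> szg ML; rewrite -mulrA; exact: Tdom.
pose nu (x : 'F_p) : R := (\sum_(z : 'I_A * 'I_K) (ratio p nn z == x))%N%:R.
have nu0 x : 0 <= nu x by exact: ler0n.
have nuT0 : 0 <= \sum_x nu x * T x by apply: sumr_ge0 => x _; rewrite mulr_ge0.
have le1 := shifted_sum_bound domT.
apply: (@le_trans _ _ ((2 * c * \sum_x nu x * T x) ^+ (2 * r))).
  apply: lerXn2r => //; rewrite nnegrE; first by rewrite !mulr_ge0 ?cabs_ge0.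
  by rewrite mulr_ge0// mulr_ge0.
rewrite exprMn ler_wpM2l ?exprn_ge0 ?(mulr_ge0 _ c0)//.
apply: (le_trans (hoelder_sum nu0 r_gt0 T0)).
have -> : \sum_x nu x = A%:R * K%:R.
  rewrite /nu -natr_sum exchange_big /= -natrM; congr _%:R.
  rewrite (eq_bigr (fun=> 1%N)) ?sum1_card ?card_prod ?card_ord// => z _.
  rewrite (bigD1 (ratio p nn z))//= eqxx big1 ?addn0// => x.
  by rewrite eq_sym => /negPf ->.
rewrite ler_wpM2l ?exprn_ge0 ?mulr_ge0//.
apply: ler_pM.
- by apply: sumr_ge0 => x _; exact: sqr_ge0.
- by apply: sumr_ge0 => x _; rewrite exprn_ge0.
- apply: le_trans (ratio_collisions pr_p R K nn Ap A_gt0).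
  rewrite /nu le_eqVlt; apply/orP; left; apply/eqP.
  under eq_bigr do rewrite -natrX.
  rewrite -natr_sum; congr _%:R.
  under eq_bigr do rewrite -mulnn big_distrl /=.
  under eq_bigr do under eq_bigr do rewrite big_distrr /=.
  rewrite exchange_big /=; apply: eq_bigr => z1 _.
  rewrite exchange_big /=; apply: eq_bigr => z2 _.
  rewrite (bigD1 (ratio p nn z1))//= eqxx mul1n big1 ?addn0; first by rewrite eq_sym.
  by move=> x; rewrite eq_sym => /negPf ->.
- under eq_bigr do rewrite TE.
  exact: block_energy_sum.
Qed.
End BurgessShift.

(** * Numerical constants *)

Section BurgessNumerics.
Variables (R : realType) (r Dn : nat).
Hypothesis r_gt0 : (0 < r)%N.

(** From [L * ln 2 <= ln (2 p)], the number of dyadic levels is at most this multiple of [l]. *)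
Definition log2_const : R := 1 + (ln 2)^-1.

(** [W <= 2 P] and [p = P ^+ (2 * r)] make both terms of the moment multiples of [P ^+ (3 * r)]. *)
Definition weil_const : R := (r ^ (2 * r))%:R * 2 ^+ r + (2 * r)%:R * 4 ^+ r.

(** [182 = 2 * 13 * 7], with 13 from [X_le] and [7 = 6 + 1] from [collision_le]; 3 comes from
    [K <= 3 H], and [2 ^+ Dn] from [W <= 2 P]. *)
Definition burgess_const (cd : R) : R :=
  (2 * (cd * log2_const)) ^+ (2 * r) *
  (3 ^+ (2 * r - 2) * (182 * (2 ^+ Dn * (log2_const * weil_const)))).

Lemma ln2_gt0 : 0 < ln 2 :> R.
Proof. by rewrite ln_gt0// ltr1n. Qed.

Lemma log2_const_ge1 : 1 <= log2_const.
Proof. by rewrite lerDl invr_ge0 ltW// ln2_gt0. Qed.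

Lemma weil_const_ge0 : 0 <= weil_const.
Proof. by rewrite addr_ge0// mulr_ge0// ?exprn_ge0. Qed.

Lemma burgess_const_ge0 cd : 0 <= cd -> 0 <= burgess_const cd.
Proof.
move=> cd0; have l0 := le_trans ler01 log2_const_ge1.
by rewrite !mulr_ge0 ?exprn_ge0 ?weil_const_ge0// !mulr_ge0.
Qed.

Variables (p L A h : nat) (P H s cd l : R).
Let W := (2 ^ L)%N.
Let W1 := (W - 1)%N.
Let K := (A * W1 + h)%N.
Hypotheses (P1 : 1 <= P) (PE : P ^+ (2 * r) = p%:R) (l1 : 1 <= l) (lnp : ln p%:R <= l).
Hypotheses (L_gt0 : (0 < L)%N) (WP : W%:R <= 2 * P) (PW : P < W%:R).
Hypotheses (H1 : 1 <= H) (H2 : H ^+ 2 <= P * p%:R).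
Hypotheses (A_gt0 : (0 < A)%N) (AW : A%:R * W1%:R <= H) (HAW : H <= 2 * (A%:R * W1%:R)).
Hypotheses (hH : h%:R <= H + 1) (s0 : 0 <= s) (cd0 : 0 <= cd) (Ap : (A < p)%N).

Let P0 : 0 < P. Proof. exact: lt_le_trans ltr01 P1. Qed.
Let H0 : 0 < H. Proof. exact: lt_le_trans ltr01 H1. Qed.
Let p_gt0 : 0 < p%:R :> R. Proof. by rewrite -PE exprn_gt0. Qed.
Let A0 : 0 < A%:R :> R. Proof. by rewrite ltr0n. Qed.
Let l0 : 0 < l. Proof. exact: lt_le_trans ltr01 l1. Qed.

Let W1E : W1%:R = W%:R - 1 :> R.
Proof. by rewrite natrB// expn_gt0. Qed.

Let W1_ge1 : 1 <= W1%:R :> R.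
Proof.
rewrite ler1n subn_gt0 /W -{1}(expn0 2) ltn_exp2l//.
Qed.

Let W1_gt0 : 0 < W1%:R :> R. Proof. exact: lt_le_trans ltr01 W1_ge1. Qed.

Let PW1 : P <= 2 * W1%:R.
Proof. by have := W1_ge1; have := PW; rewrite W1E; lra. Qed.

Let AH : A%:R <= H.
Proof. by apply: le_trans AW; rewrite ler_peMr// ltW. Qed.

Let K3 : K%:R <= 3 * H.
Proof. by rewrite /K natrD natrM; have := hH; have := AW; have := H1; lra. Qed.

Let L_log : L%:R <= log2_const * l.
Proof.
have Wp : W%:R <= 2 * p%:R :> R.
  apply: (le_trans WP); rewrite ler_pM2l// -PE -[X in X <= _]expr1.
  by rewrite ler_weXn2l// muln_gt0.
have : ln W%:R <= ln (2 * p%:R) :> R.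
  by rewrite ler_ln// posrE ?mulr_gt0// (lt_trans P0 PW).
rewrite lnM ?posrE// /W natrX lnXn// -[ln 2 *+ L]mulr_natl => h1.
have n2 := ln2_gt0.
rewrite -(ler_pM2r n2) mulrDl mul1r mulrDl mulrAC mulVf ?gt_eqF// mul1r.
apply: (le_trans h1); apply: lerD => //.
by rewrite -[X in X <= _]mul1r ler_wpM2r// ltW.
Qed.


(** [A W1 K <= 3 H ^ 2 <= 3 P p <= 6 W1 p]: the upper bound on [H] enters here. *)
Let X_le : ((2 * A * K) %/ p).+1%:R <= 13 :> R.
Proof.
suff : (2 * A * K)%:R <= (12 * p)%:R :> R.
  rewrite !ler_nat => h1; rewrite ltnS.
  have p0 : (0 < p)%N by rewrite -(ltr0n R).
  by rewrite -(mulnK 12 p0) leq_div2r.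
rewrite !natrM -(ler_pM2r W1_gt0).
have h1 : A%:R * W1%:R * K%:R <= H * (3 * H) by rewrite ler_pM// mulr_ge0// ltW.
have h2 : P * p%:R <= 2 * W1%:R * p%:R by rewrite ler_pM2r.
have := H2; move: h1 h2; rewrite expr2.
move: (A%:R : R) (W1%:R : R) (K%:R : R) (p%:R : R) P H => a w k q u v; lra.
Qed.

Let lnA : 1 + ln A%:R <= 2 * l.
Proof.
have : ln A%:R <= l by apply: le_trans lnp; rewrite ler_ln ?posrE// ler_nat ltnW.
by have := l1; lra.
Qed.

Let collision_le :
  2 * ((2 * A * K) %/ p).+1%:R * (K%:R * (A%:R * (1 + ln A%:R)) + A%:R ^+ 2)
  <= 182 * (A%:R * H * l).
Proof.
have AHl : 0 <= A%:R * H * l by rewrite !mulr_ge0// ltW.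
have lnA0 : 0 <= ln A%:R :> R by rewrite ln_ge0// ler1n.
have h1 : K%:R * (A%:R * (1 + ln A%:R)) <= 6 * (A%:R * H * l).
  apply: (@le_trans _ _ (3 * H * (A%:R * (2 * l)))); last by move: (A%:R : R) => a; lra.
  by apply: ler_pM => //; [rewrite mulr_ge0 ?addr_ge0// ltW | rewrite ler_pM2l].
have h2 : A%:R ^+ 2 <= A%:R * H * l.
  rewrite expr2 -mulrA ler_pM2l// (le_trans AH)// ler_peMr// ltW//.
apply: (@le_trans _ _ (2 * 13 * (7 * (A%:R * H * l)))); last by lra.
apply: ler_pM.
- by rewrite mulr_ge0.
- by rewrite addr_ge0 ?sqr_ge0// !mulr_ge0 ?addr_ge0// ltW.
- by rewrite ler_pM2l.
- by move: h1 h2; lra.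
Qed.

Let sqrt_p : Num.sqrt p%:R = P ^+ r.
Proof. by rewrite -PE mulnC exprM sqrtr_sqr ger0_norm ?exprn_ge0// ltW. Qed.

Let energy_le :
  L%:R * ((r ^ (2 * r))%:R * (p%:R * W%:R ^+ r)
     + (2 * r)%:R * (Num.sqrt p%:R * W%:R ^+ (2 * r)))
  <= log2_const * l * (weil_const * P ^+ (3 * r)).
Proof.
have Wr n : W%:R ^+ n <= 2 ^+ n * P ^+ n.
  by rewrite -exprMn lerXn2r// ?nnegrE// mulr_ge0// ltW.
have PX n : 0 <= P ^+ n by rewrite exprn_ge0// ltW.
apply: ler_pM => //.
rewrite /weil_const mulrDl; apply: lerD.
  rewrite -[X in _ <= X]mulrA ler_wpM2l// -PE (mulSn 2 r) addnC exprD mulrCA.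
  by rewrite ler_wpM2l.
rewrite -[X in _ <= X]mulrA ler_wpM2l// sqrt_p (mulSn 2 r) exprD mulrCA.
rewrite ler_wpM2l//; apply: (le_trans (Wr _)).
rewrite exprM; suff -> : 2 ^+ 2 = 4 :> R by []. 
by rewrite -natrX.
Qed.

Lemma burgess_numeric :
  (A%:R * W1%:R * s) ^+ (2 * r) <=
  (2 * (cd * L%:R)) ^+ (2 * r) *
  ((A%:R * K%:R) ^+ (2 * r - 2) *
   ((2 * ((2 * A * K) %/ p).+1%:R * (K%:R * (A%:R * (1 + ln A%:R)) + A%:R ^+ 2)) *
    ((W ^ Dn)%:R * (L%:R * ((r ^ (2 * r))%:R * (p%:R * W%:R ^+ r)
     + (2 * r)%:R * (Num.sqrt p%:R * W%:R ^+ (2 * r))))))) ->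
  s ^+ (2 * r) <= 4 ^+ r * burgess_const cd *
     (l ^+ (2 * r + 2) * (H ^+ (2 * r - 2) * P ^+ (Dn + r + 1))).
Proof.
have lg0 := le_trans ler01 log2_const_ge1.
have PX n : 0 <= P ^+ n by rewrite exprn_ge0// ltW.
move=> hyp.
have step1 : (A%:R * W1%:R * s) ^+ (2 * r) <=
   burgess_const cd * (l ^+ (2 * r + 2) * ((A%:R * H) ^+ (2 * r - 2) * (A%:R * H)
     * P ^+ (Dn + 3 * r))).
  apply: (le_trans hyp).
  apply: (@le_trans _ _ ((2 * (cd * log2_const) * l) ^+ (2 * r) *
    ((3 * (A%:R * H)) ^+ (2 * r - 2) * (182 * (A%:R * H * l) *
      (2 ^+ Dn * P ^+ Dn * (log2_const * l * (weil_const * P ^+ (3 * r)))))))); last first.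
    rewrite le_eqVlt; apply/orP; left; apply/eqP; rewrite /burgess_const.
    rewrite [(2 * (cd * _) * l) ^+ _]exprMn [(3 * _) ^+ _]exprMn.
    rewrite !exprD; ring.
  have W0 : 0 <= W%:R :> R by [].
  have E0 : 0 <= L%:R * ((r ^ (2 * r))%:R * (p%:R * W%:R ^+ r)
     + (2 * r)%:R * (Num.sqrt p%:R * W%:R ^+ (2 * r))) :> R.
    by apply: mulr_ge0 => //; apply: addr_ge0; rewrite !mulr_ge0 ?sqrtr_ge0 ?exprn_ge0.
  have lnA0 : 0 <= ln A%:R :> R by rewrite ln_ge0// ler1n.
  have X0 : 0 <= 2 * ((2 * A * K) %/ p).+1%:R * (K%:R * (A%:R * (1 + ln A%:R)) + A%:R ^+ 2) :> R.
    by rewrite mulr_ge0 ?mulr_ge0// addr_ge0 ?sqr_ge0// !mulr_ge0 ?addr_ge0// ltW.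
  have AK0 : 0 <= A%:R * K%:R :> R by rewrite mulr_ge0.
  have prod5 (a a' b b' c c' e e' g g' : R) : 0 <= a -> a <= a' -> 0 <= b -> b <= b' ->
      0 <= c -> c <= c' -> 0 <= e -> e <= e' -> 0 <= g -> g <= g' ->
      a * (b * (c * (e * g))) <= a' * (b' * (c' * (e' * g'))).
    by move=> *; do 4 (apply: ler_pM; rewrite ?mulr_ge0//).
  apply: prod5 => //.
  - by rewrite exprn_ge0// !mulr_ge0.
  - apply: lerXn2r; rewrite ?nnegrE ?mulr_ge0 ?(ltW l0)//.
    by rewrite -!mulrA ler_pM2l// ler_wpM2l.
  - apply: lerXn2r; rewrite ?nnegrE ?mulr_ge0 ?(ltW H0)//.
    by rewrite [X in _ <= X]mulrCA ler_pM2l.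
  rewrite natrX -exprMn; apply: lerXn2r; rewrite ?nnegrE ?mulr_ge0 ?(ltW P0)//.
have bc0 := burgess_const_ge0 cd0.
move: step1; move: (burgess_const cd) bc0 => bc bc0.
have [k rE] : exists k, r = k.+1 by exists r.-1; rewrite prednK.
have e2 : (2 * r = (2 * k).+2)%N by rewrite rE mulnS.
rewrite !e2 (_ : ((2 * k).+2 - 2 = 2 * k)%N) ?subSS ?subn0//.
set el := l ^+ _; have el0 : 0 <= el by rewrite exprn_ge0// ltW.
move=> step1.
(* Trade one factor [H] for [2 A W1], which leaves [H ^ (2 r - 2)], and cancel [A ^ (2 r) W1]. *)
have step2 : W1%:R ^+ (2 * k).+1 * s ^+ (2 * k).+2 <=
    2 * (bc * (el * (H ^+ (2 * k) * P ^+ (Dn + 3 * r)))).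
  have Aw : 0 < A%:R ^+ (2 * k).+2 * W1%:R :> R by rewrite mulr_gt0// exprn_gt0.
  rewrite -(ler_pM2l Aw).
  have -> : A%:R ^+ (2 * k).+2 * W1%:R * (W1%:R ^+ (2 * k).+1 * s ^+ (2 * k).+2) =
    (A%:R * W1%:R * s) ^+ (2 * k).+2.
    by rewrite !exprMn [W1%:R ^+ (2 * k).+2]exprS; ring.
  apply: (le_trans step1).
  have -> : bc * (el * ((A%:R * H) ^+ (2 * k) * (A%:R * H) * P ^+ (Dn + 3 * r))) =
    (A%:R ^+ (2 * k).+1 * bc * el * H ^+ (2 * k) * P ^+ (Dn + 3 * r)) * H.
    by rewrite !exprMn exprS; ring.
  have -> : A%:R ^+ (2 * k).+2 * W1%:R * (2 * (bc * (el * (H ^+ (2 * k) * P ^+ (Dn + 3 * r))))) =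
    (A%:R ^+ (2 * k).+1 * bc * el * H ^+ (2 * k) * P ^+ (Dn + 3 * r)) * (2 * (A%:R * W1%:R)).
    by rewrite [A%:R ^+ (2 * k).+2]exprS; ring.
  apply: ler_wpM2l => //; apply: mulr_ge0 => //.
  apply: mulr_ge0; last by rewrite exprn_ge0// ltW.
  by apply: mulr_ge0 => //; apply: mulr_ge0 => //; rewrite exprn_ge0.
(* The remaining [2 r - 1] factors [W1] are bounded below by [P / 2]. *)
have PP : 0 < P ^+ (2 * k).+1 by rewrite exprn_gt0.
rewrite -(ler_pM2l PP).
apply: (@le_trans _ _ (2 ^+ (2 * k).+1 * (W1%:R ^+ (2 * k).+1 * s ^+ (2 * k).+2))).
  rewrite mulrA -exprMn ler_wpM2r ?exprn_ge0// lerXn2r// ?nnegrE ?mulr_ge0// ltW//.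
apply: (@le_trans _ _ (2 ^+ (2 * k).+1 * (2 * (bc * (el * (H ^+ (2 * k) * P ^+ (Dn + 3 * r))))))).
  by rewrite ler_wpM2l ?exprn_ge0.
rewrite le_eqVlt; apply/orP; left; apply/eqP.
have -> : (Dn + 3 * r = (2 * k).+1 + (Dn + r + 1))%N by rewrite rE; clear; lia.
have -> : 4 ^+ r = 2 ^+ (2 * k).+1 * 2 :> R.
  by rewrite -exprSr -e2 exprM; congr (_ ^+ _); rewrite -natrX.
by rewrite exprD; ring.
Qed.
End BurgessNumerics.

Lemma dyadic_bracket (R : realType) (P : R) : 1 <= P ->
  exists2 L, (0 < L)%N & (2 ^ L)%:R <= 2 * P /\ P < (2 ^ L)%:R.
Proof.
move=> P1; have P0 : 0 <= P by exact: le_trans ler01 P1.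
have /andP[t1 t2] := trunc_itv P0.
have t_gt0 : (0 < Num.trunc P)%N.
  by rewrite -ltnS -(ltr_nat R) (le_lt_trans P1).
have /andP[k1 k2] := trunc_log_bounds (ltnSn 1) t_gt0.
exists (trunc_log 2 (Num.trunc P)).+1 => //; split.
  by rewrite expnS natrM ler_pM2l// (le_trans _ t1)// ler_nat.
by apply: (lt_le_trans t2); rewrite ler_nat.
Qed.

Lemma triangular_sum (R : realType) (d : nat) :
  (\sum_(j < d.+1) j)%N%:R = (d * (d + 1))%:R / 2 :> R.
Proof.
have E : ((\sum_(j < d.+1) j) * 2 = d * (d + 1))%N.
  elim: d => [|d IH]; first by rewrite big_ord1.
  by rewrite big_ord_recr /= mulnDl IH; lia.
by rewrite -E natrM mulfK.
Qed.

(** * Choice of the parameters and the final bound *)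

Section Assembly.
Variables (R : realType) (d r : nat).
Hypothesis r_gt0 : (0 < r)%N.
Let Dn := (\sum_(j < d.+1) j)%N.
Let cd : R := 1 + phase_const R d.

Let cd0 : 0 <= cd.
Proof. by rewrite addr_ge0 ?phase_const_ge0. Qed.

Definition power_const : R := 4 ^+ r * burgess_const r Dn cd + 4 ^+ r.+1.

Lemma power_const_ge0 : 0 <= power_const.
Proof.
have b0 := burgess_const_ge0 r Dn cd0.
by rewrite /power_const addr_ge0 ?exprn_ge0// mulr_ge0 ?exprn_ge0.
Qed.

Lemma mixed_sum_power_bound (q : nat) (chi : int -> R[i]%C) (f : {poly R}) (N H P l : R) :
  prime q -> dirichlet_character q chi -> ~ (chi =1 principal_character R q) ->
  (size f <= d.+1)%N -> 1 <= H -> 1 <= P -> P ^+ (2 * r) = q%:R ->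
  H ^+ 2 < P * q%:R -> 1 <= l -> ln q%:R <= l ->
  cabs (mixed_sum f chi N H) ^+ (2 * r) <=
    power_const * (l ^+ (4 * r) * (H ^+ (2 * r - 2) * P ^+ (Dn + r + 1))).
Proof.
move=> pr_q dchi nprin szf H1 P1 PE H2 l1 lnq.
(* The main case yields [l ^ (2 r + 2)], absorbed into [l ^ (4 r)], the [2 r]-th power of a squared
   logarithm. *)
have r42 : (2 * r + 2 <= 4 * r)%N by move: r_gt0; clear; lia.
have P0 : 0 < P := lt_le_trans ltr01 P1.
have H0 : 0 < H := lt_le_trans ltr01 H1.
have l0 : 0 < l := lt_le_trans ltr01 l1.
have [n1 [h [hH SE]]] := window_sum (fun n => expi2pi f.[n%:~R] * chi n) N H1.
rewrite /mixed_sum SE.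
under eq_bigr do rewrite (char_FpE pr_q dchi).
set S := \sum_(i < h) _.
have [L L_gt0 [WP PW]] := dyadic_bracket P1.
pose W1 := (2 ^ L - 1)%N.
have W1E : W1%:R = (2 ^ L)%:R - 1 :> R by rewrite natrB// expn_gt0.
have W1_gt0n : (0 < W1)%N by rewrite subn_gt0 -{1}(expn0 2) ltn_exp2l.
have W1_gt0 : 0 < W1%:R :> R by rewrite ltr0n.
have Hr0 : 0 <= H ^+ (2 * r - 2) by rewrite exprn_ge0// ltW.
have tail0 : 0 <= H ^+ (2 * r - 2) * P ^+ (Dn + r + 1).
  by rewrite mulr_ge0// exprn_ge0// ltW.
have ltail0 : 0 <= l ^+ (4 * r) * (H ^+ (2 * r - 2) * P ^+ (Dn + r + 1)).
  by rewrite mulr_ge0// exprn_ge0// ltW.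
have bc0 := burgess_const_ge0 r Dn cd0.
(* For [H < W1] there is no room for a shift ([A] would be 0), but the trivial bound [2 H] with
   [H <= 2 P] suffices. *)
have [HW|WH] := ltP H W1%:R.
  have sH : cabs S <= 2 * H.
    apply: (@le_trans _ _ h%:R); last by move: hH H1; lra.
    apply: (le_trans (cabs_le_sum _ _ _)).
    apply: (@le_trans _ _ (\sum_(i < h) 1)); last by rewrite sumr_const card_ord.
    apply: ler_sum => i _; rewrite cabsM cabs_expi2pi mul1r.
    apply: (cabs_chi_le1 pr_q (char_FpM pr_q dchi) (char_Fp1 pr_q dchi)).
    exact: char_Fp0.
  apply: (@le_trans _ _ ((2 * H) ^+ (2 * r))).
    by apply: lerXn2r; rewrite ?nnegrE ?cabs_ge0 ?mulr_ge0// ltW.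
  apply: (@le_trans _ _ (4 ^+ r.+1 * (H ^+ (2 * r - 2) * P ^+ (Dn + r + 1)))).
    have r2 : (2 * r = 2 * r - 2 + 2)%N by rewrite subnK// leq_pmulr.
    rewrite exprMn {2}r2 exprD exprM (_ : 2 ^+ 2 = 4 :> R); last by rewrite -natrX.
    rewrite [4 ^+ r.+1]exprSr -[X in _ <= X]mulrA ler_wpM2l ?exprn_ge0// [X in _ <= X]mulrCA ler_wpM2l//.
    have H2P : H ^+ 2 <= (2 * P) ^+ 2.
      apply: lerXn2r; rewrite ?nnegrE ?mulr_ge0 ?(ltW H0) ?(ltW P0)//.
      by move: HW WP; rewrite W1E; lra.
    apply: (le_trans H2P); rewrite exprMn (_ : 2 ^+ 2 = 4 :> R); last by rewrite -natrX.
    by rewrite ler_pM2l// ler_weXn2l// addn1 ltnS (leq_trans r_gt0)// leq_addl.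
  apply: (@le_trans _ _ (4 ^+ r.+1 * (l ^+ (4 * r) * (H ^+ (2 * r - 2) * P ^+ (Dn + r + 1))))).
    by rewrite ler_wpM2l ?exprn_ge0// ler_peMl// exprn_ege1.
  by rewrite ler_wpM2r// /power_const lerDr mulr_ge0 ?exprn_ge0.
pose A := Num.trunc (H / W1%:R).
have HW0 : 0 <= H / W1%:R by rewrite divr_ge0// ltW.
have /andP[A1 A2] := trunc_itv HW0.
rewrite -/A ler_pdivlMr// in A1; rewrite -/A ltr_pdivrMr// in A2.
have A_gt0 : (0 < A)%N.
  rewrite -ltnS -(ltr_nat R); apply: le_lt_trans (_ : 1 <= H / W1%:R) _.
    by rewrite ler_pdivlMr// mul1r.
  by rewrite ltr_pdivrMr.
have AR1 : 1 <= A%:R :> R by rewrite ler1n.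
have HAW : H <= 2 * (A%:R * W1%:R).
  apply: ltW; apply: (lt_le_trans A2); rewrite mulrA ler_pM2r// -natr1.
  by move: AR1; lra.
have PleP : P ^+ 2 <= q%:R by rewrite -PE ler_weXn2l// leq_pmulr.
have q1 : 1 <= q%:R :> R by rewrite ler1n prime_gt0.
have q0 : 0 < q%:R :> R := lt_le_trans ltr01 q1.
have Pq : P <= q%:R by apply: le_trans PleP; rewrite expr2 ler_peMl// ltW.
have Hq : H < q%:R.
  rewrite -(ltr_pXn2r (ltn0Sn 1)) ?nnegrE ?(ltW H0) ?(ltW q0)//.
  by apply: (lt_le_trans H2); rewrite expr2 ler_pM2r.
have Aq : (A < q)%N.
  rewrite -(ltr_nat R); apply: le_lt_trans Hq; apply: le_trans A1.
  by rewrite ler_peMr// ler1n.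
have Lq : (2 ^ L <= q)%N.
  have [P2|P2] := leP 2 P.
    rewrite -(ler_nat R); apply: (le_trans WP); apply: le_trans PleP.
    by rewrite expr2 ler_pM2r.
  have L1 : (2 ^ L <= 2 ^ 1)%N.
    rewrite leqNgt ltn_exp2l//; apply/negP => L2.
    have : (2 ^ 2)%:R <= (2 ^ L)%:R :> R by rewrite ler_nat leq_exp2l.
    by move: WP P2; rewrite natrX; lra.
  by apply: (leq_trans L1); rewrite expn1 prime_gt1.
have key := burgess_power_bound pr_q (char_FpM pr_q dchi) (char_Fp1 pr_q dchi)
  (char_Fp_sum0 pr_q dchi nprin) (char_Fp0 pr_q dchi) h n1 r_gt0 Lq Aq A_gt0 szf.
have := burgess_numeric r_gt0 P1 PE l1 lnq L_gt0 WP PW H1 (ltW H2) A_gt0 A1 HAW hH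
  (cabs_ge0 S) cd0 Aq key.
move=> /le_trans; apply.
apply: (@le_trans _ _ (4 ^+ r * burgess_const r Dn cd *
   (l ^+ (4 * r) * (H ^+ (2 * r - 2) * P ^+ (Dn + r + 1))))).
  apply: ler_wpM2l; first by rewrite mulr_ge0 ?exprn_ge0.
  by rewrite ler_wpM2r// ler_weXn2l.
by rewrite ler_wpM2r// /power_const lerDl exprn_ge0.
Qed.
End Assembly.

Local Open Scope classical_set_scope.
Local Open Scope ring_scope.
Local Open Scope complex_scope.

Theorem theorem1p2 (R : realType) (d r : nat) (r_ge1 : (1 <= r)%N) :
  let D : R := (d * (d + 1))%:R / 2 in
  exists C : R, 0 < C /\
    forall (q : nat) (chi : int -> R[i]) (f : {poly R}) (N H : R),
      prime q ->
      dirichlet_character q chi ->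
      ~ (chi =1 principal_character R q) ->
      (size f).-1 = d ->
      1 <= H ->
      H < q%:R `^ (1 / 2 + 1 / (4 * r%:R)) ->
      `|mixed_sum f chi N H| <=
        (C * (H `^ (1 - 1 / r%:R)
              * q%:R `^ ((r%:R + 1 + D) / (4 * r%:R ^+ 2))
              * ln q%:R ^+ 2))%:C.
Proof.
move=> D; set Dn := (\sum_(j < d.+1) j)%N.
have DE : D = Dn%:R by rewrite triangular_sum.
have ln2 := @ln2_gt0 R.
have ln2_le1 : ln 2 <= 1 :> R.
  have E2 : 2 = 1 + 1 :> R by lra.
  by rewrite E2; apply: le_ln1Dx; lra.
pose C0 : R := power_const R d r * (ln 2)^-1 ^+ (4 * r).
have C00 : 0 <= C0 by rewrite mulr_ge0 ?power_const_ge0// exprn_ge0// invr_ge0 ltW.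
(* With a constant at least 1, [C0 <= (1 + C0) ^ (2 r)], so no root of [C0] is taken. *)
exists (1 + C0); split; first by rewrite ltr_pwDl.
move=> q chi f N H pr_q dchi nprin szf H1 Hlt.
rewrite -cabs_leC.
have r0 : r%:R != 0 :> R by rewrite pnatr_eq0 -lt0n.
have q1 : 1 <= q%:R :> R by rewrite ler1n prime_gt0.
have q0 : 0 < q%:R :> R := lt_le_trans ltr01 q1.
have H0 : 0 < H := lt_le_trans ltr01 H1.
pose P : R := q%:R `^ (2 * r%:R)^-1.
have PX n : P ^+ n = q%:R `^ (n%:R / (2 * r%:R)).
  by rewrite -powR_mulrn ?powR_ge0// -powRrM mulrC.
have P1 : 1 <= P.
  by rewrite -(powRr0 q%:R) ler_powR// invr_ge0 mulr_ge0.
have PE : P ^+ (2 * r) = q%:R.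
  by rewrite PX natrM divff ?mulf_neq0// powRr1// ltW.
have H2 : H ^+ 2 < P * q%:R.
  have := Hlt; rewrite -(ltr_pXn2r (ltn0Sn 1)) ?nnegrE ?powR_ge0 ?(ltW H0)//.
  move=> /lt_le_trans; apply; rewrite -powR_mulrn ?powR_ge0// -powRrM.
  rewrite -{2}(powRr1 (ltW q0)) -powRD; last by rewrite gt_eqF ?implybT.
  rewrite le_eqVlt; apply/orP; left; apply/eqP; congr (_ `^ _).
  by field.
(* [ln q] is below 1 for [q = 2]; dividing by [ln 2] makes [l >= 1], and the factor
   [(ln 2)^-1 ^+ (4 * r)] in [C0] pays for it. *)
pose l : R := ln q%:R / ln 2.
have lnq : ln 2 <= ln q%:R :> R by rewrite ler_ln ?posrE// ler_nat prime_gt1.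
have l1 : 1 <= l by rewrite ler_pdivlMr// mul1r.
have lnl : ln q%:R <= l.
  by rewrite ler_pdivlMr// ler_piMr// (le_trans (ltW ln2)).
have szf' : (size f <= d.+1)%N by rewrite -szf leqSpred.
have key := mixed_sum_power_bound r_ge1 N pr_q dchi nprin szf' H1 P1 PE H2 l1 lnl.
set V := (X in (1 + C0) * X).
have V0 : 0 <= V by rewrite /V mulr_ge0 ?sqr_ge0// mulr_ge0 ?powR_ge0.
have VE : V ^+ (2 * r) = H ^+ (2 * r - 2) * P ^+ (Dn + r + 1) * ln q%:R ^+ (4 * r).
  rewrite /V !exprMn; congr (_ * _ * _).
  - rewrite -!powR_mulrn ?powR_ge0 ?(ltW H0)// -powRrM; congr (_ `^ _).
    by rewrite natrB ?leq_pmulr// !natrM; field.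
  - rewrite PX -powR_mulrn ?powR_ge0// -powRrM; congr (_ `^ _).
    by rewrite DE natrM (natrD _ (Dn + r)%N) (natrD _ Dn); field.
  - by rewrite -exprD -mulnDl.
have r2 : (0 < 2 * r)%N by rewrite muln_gt0.
clearbody V; rewrite -(ler_pXn2r r2) ?nnegrE ?cabs_ge0 ?mulr_ge0 ?addr_ge0//.
apply: (le_trans key); rewrite [X in _ <= X]exprMn VE /l expr_div_n.
apply: (@le_trans _ _ (C0 * (H ^+ (2 * r - 2) * P ^+ (Dn + r + 1) * ln q%:R ^+ (4 * r)))).
  rewrite le_eqVlt; apply/orP; left; apply/eqP; rewrite /C0 exprVn.
  by ring.
rewrite -VE ler_wpM2r ?exprn_ge0//.
apply: (@le_trans _ _ (1 + C0)); first by rewrite lerDr.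
by rewrite -[X in X <= _]expr1 ler_weXn2l// lerDl.
Qed.
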